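(* Let $k$ be a positive integer and let $f$ be a function on $[0,\infty)$ such that the functions $x\mapsto f(|x|)$ are absolutely integrable over $\mathbf{R}^n$ for all $n$ with $1\le n\le 2k+2$. Then, for all $\rho>0$, \[ \mathcal F_{2k+1}(f)(\rho) = \frac{1}{(2\pi)^k}\sum_{\ell=1}^{k} \frac{(-1)^\ell (2k-\ell-1)!}{2^{k-\ell}\,(k-\ell)!\,(\ell-1)!}\, \frac{1}{\rho^{2k-\ell}}\, \Big(\frac{d}{d\rho}\Big)^\ell \mathcal F_{1}(f)(\rho) \] and \[ \mathcal F_{2k+2}(f)(\rho) = \frac{1}{(2\pi)^k}\sum_{\ell=1}^{k} \frac{(-1)^\ell (2k-\ell-1)!}{2^{k-\ell}\,(k-\ell)!\,(\ell-1)!}\, \frac{1}{\rho^{2k-\ell}}\, \Big(\frac{d}{d\rho}\Big)^\ell \mathcal F_{2}(f)(\rho). \]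
   Context: For $\Phi\in L^1(\mathbf{R}^m)$ the Fourier transform is $F_m(\Phi)(\xi)=\int_{\mathbf{R}^m}\Phi(x)\,e^{-2\pi i x\cdot\xi}\,dx$. If $\Phi(x)=f(|x|)$ is radial, then $F_m(\Phi)$ is also radial, and $\mathcal F_m(f)$ denotes its radial profile: $\mathcal F_m(f)(\rho)=F_m(\Phi)(\xi)$ for $\rho=|\xi|$. *)

(* Defs.v *)
From HB Require Import structures.
From mathcomp Require Import all_boot all_order all_algebra.
From mathcomp Require Import complex.
From mathcomp Require Import all_classical all_reals all_analysis.

Set Implicit Arguments.
Unset Strict Implicit.
Unset Printing Implicit Defensive.

Import Order.TTheory GRing.Theory Num.Theory.
Import numFieldNormedType.Exports.

Local Open Scope classical_set_scope.
Local Open Scope ring_scope.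
Local Open Scope complex_scope.

Definition tcons (T : Type) (n : nat) (p : T * n.-tuple T) : n.+1.-tuple T :=
  [tuple of p.1 :: p.2].

Definition tuncons (T : Type) (n : nat) (t : n.+1.-tuple T) : T * n.-tuple T :=
  (thead t, [tuple of behead t]).

Lemma tconsK (T : Type) (n : nat) : cancel (@tcons T n) (@tuncons T n).
Proof.
by move=> [x t]; congr pair; exact: val_inj.
Qed.

Lemma measurable_tcons d (T : measurableType d) (n : nat) :
  measurable_fun [set: T * n.-tuple T] (@tcons T n).
Proof. exact: (measurable_cons measurable_fst measurable_snd). Qed.

Lemma measurable_tuncons d (T : measurableType d) (n : nat) :
  measurable_fun [set: n.+1.-tuple T] (@tuncons T n).
Proof.
by apply: measurable_fun_pair; [exact: measurable_tnth | exact: measurable_behead].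
Qed.

Section lebesgue_tuple_step.
Context (R : realType) (n : nat).
Let T : measurableType _ := measurableTypeR R.
Variable mu : {sigma_finite_measure set (n.-tuple T) -> \bar R}.

Definition lebesgue_tcons : set (n.+1.-tuple T) -> \bar R :=
  pushforward (lebesgue_measure \x mu)%E (@tcons T n).

Let mtcons := @measurable_tcons _ T n.

Let lebesgue_tcons0 : lebesgue_tcons set0 = 0%E.
Proof. by rewrite /lebesgue_tcons /pushforward preimage_set0 measure0. Qed.

Let lebesgue_tcons_ge0 A : (0 <= lebesgue_tcons A)%E.
Proof. exact: measure_ge0. Qed.

Let lebesgue_tcons_sigma_additive : semi_sigma_additive lebesgue_tcons.
Proof.
move=> F mF tF mUF; rewrite /lebesgue_tcons /pushforward preimage_bigcup.
apply: measure_semi_sigma_additive.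
- by move=> i; rewrite -[X in measurable X]setTI; exact: mtcons.
- apply/trivIsetP => /= i j _ _ ij; rewrite -preimage_setI.
  by move/trivIsetP : tF => /(_ _ _ _ _ ij) ->//; rewrite preimage_set0.
- by rewrite -preimage_bigcup -[X in measurable X]setTI; exact: mtcons.
Qed.

HB.instance Definition _ := isMeasure.Build _ _ _ lebesgue_tcons
  lebesgue_tcons0 lebesgue_tcons_ge0 lebesgue_tcons_sigma_additive.

Lemma lebesgue_tcons_sigma_finite : sigma_finite setT lebesgue_tcons.
Proof.
have /sigma_finiteP[F [TF ndF Foo]] :=
  sigma_finiteT (lebesgue_measure : set T -> \bar R).
have /sigma_finiteP[G [TG ndG Goo]] := sigma_finiteT mu.
exists (fun i => @tuncons T n @^-1` (F i `*` G i)).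
  rewrite -preimage_bigcup -[LHS](preimage_setT (@tuncons T n)).
  congr (_ @^-1` _); rewrite -setXTT TF TG predeqE => -[x y]; split.
    move=> [/= [i _ Fix] [j _ Gjy]]; exists (maxn i j) => //; split.
    - by move: x Fix; exact/subsetPset/ndF/leq_maxl.
    - by move: y Gjy; exact/subsetPset/ndG/leq_maxr.
  by move=> [i _ []/= ? ?]; split; exists i.
move=> i; have [mF {}Foo] := Foo i; have [mG {}Goo] := Goo i; split.
  by rewrite -[X in measurable X]setTI; apply: measurable_tuncons => //;
    exact: measurableX.
rewrite /lebesgue_tcons /pushforward -comp_preimage.
rewrite (_ : _ \o _ = id) ?preimage_id; last first.
  by apply/funext => p; exact: tconsK.
by rewrite product_measure1E// lte_mul_pinfty// ge0_fin_numE.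
Qed.

HB.instance Definition _ := Measure_isSigmaFinite.Build _ _ _ lebesgue_tcons
  lebesgue_tcons_sigma_finite.

End lebesgue_tuple_step.

(* n-fold product of the one-dimensional Lebesgue measure, on the Borel sets
   of R^n; R^0 is a point of mass 1. *)
Fixpoint borel_lebesgue (R : realType) (n : nat) :
    {sigma_finite_measure set (n.-tuple (measurableTypeR R)) -> \bar R} :=
  if n is m.+1 then lebesgue_tcons (borel_lebesgue R m)
  else \d_([tuple]).

(* The carrier is n.-tuple R with the sigma-algebra of all Lebesgue measurable
   (i.e., Caratheodory measurable) sets, not only the Borel sets. *)
Definition lebesgue_space (R : realType) (n : nat) : measurableType _ :=
  caratheodory_type (measure_extension.mu_ext (borel_lebesgue R n)).

Definition lebesgue_tuple (R : realType) (n : nat) :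
    {measure set (lebesgue_space R n) -> \bar R} :=
  @completed_measure_extension _ _ _ (borel_lebesgue R n).

Definition dotp (R : realType) (n : nat) (x y : n.-tuple R) : R :=
  \sum_(i < n) tnth x i * tnth y i.

Definition enorm (R : realType) (n : nat) (x : n.-tuple R) : R :=
  Num.sqrt (dotp x x).

Definition abs_integrable (R : realType) (n : nat) (Phi : n.-tuple R -> R[i]) :=
  [/\ measurable_fun setT
        (fun x : lebesgue_space R n => complex.Re (Phi x) : measurableTypeR R),
      measurable_fun setT
        (fun x : lebesgue_space R n => complex.Im (Phi x) : measurableTypeR R)
    & (\int[lebesgue_tuple R n]_x (ComplexField.Normc.normc (Phi x))%:E
         < +oo)%E].

Definition cintegral (R : realType) (n : nat) (Phi : n.-tuple R -> R[i]) : R[i] :=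
  (\int[lebesgue_tuple R n]_x complex.Re (Phi x)) +i*
  (\int[lebesgue_tuple R n]_x complex.Im (Phi x)).

(* expi t = e^{i t} *)
Definition expi (R : realType) (t : R) : R[i] := cos t +i* sin t.

Definition fourier (R : realType) (n : nat) (Phi : n.-tuple R -> R[i])
    (xi : n.-tuple R) : R[i] :=
  cintegral (fun x => Phi x * expi (- (2 * pi * dotp x xi))).

(* A function on [0, +oo[ is encoded as f : R -> R[i]; only its values on
   [0, +oo[ matter here. *)
Definition radial (R : realType) (n : nat) (f : R -> R[i]) (x : n.-tuple R) :
    R[i] :=
  f (enorm x).
Arguments radial {R} n f x.

(* (rho, 0, ..., 0), of norm rho when 0 < n and 0 <= rho. *)
Definition axis_point (R : realType) (n : nat) (rho : R) : n.-tuple R :=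
  [tuple if i == 0%N :> nat then rho else 0 | i < n].
Arguments axis_point {R} n rho.

(* The Fourier transform of a radial function is radial, so its radial profile
   at rho is its value at any xi of norm rho, here (rho, 0, ..., 0). *)
Definition radial_fourier (R : realType) (n : nat) (f : R -> R[i]) (rho : R) :
    R[i] :=
  fourier (radial n f) (axis_point n rho).
Arguments radial_fourier {R} n f rho.

(* Derivatives of complex-valued functions of a real variable are taken
   componentwise. *)
Definition cderive1n (R : realType) (l : nat) (F : R -> R[i]) (t : R) : R[i] :=
  derive1n l (fun s => complex.Re (F s)) t +i* derive1n l (fun s => complex.Im (F s)) t.

(* F has derivatives up to order k at every point of ]0, +oo[; needed because
   derive1n is a total operator. *)
Definition cderivable_pos (R : realType) (k : nat) (F : R -> R[i]) :=
  forall (l : nat) (t : R), (l < k)%N -> 0 < t ->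
    derivable (derive1n l (fun s => complex.Re (F s))) t 1 /\
    derivable (derive1n l (fun s => complex.Im (F s))) t 1.

(* Main.v *)
(** Write [F_n] for the radial Fourier transform in dimension [n], [G(u)] for
    [f(sqrt u)] and [x = (s, y)] with [y] in [R^(n-1)]. The identity behind the
    formula is [F_n'(rho) = - 2 pi rho F_(n+2)(rho)].  Differentiating under the
    integral gives [F_n'(rho) = - 2 pi int s sin(2 pi rho s) G(|x|^2) dx].  In
    dimension [n + 2], integrating out two coordinates replaces [G(|x|^2)] by
    [pi int_(u > |x|^2) G(u) du], because the disc of squared radius [u] has area
    [pi u]; exchanging this tail integral with the integral over [s] of
    [cos(2 pi rho s)] produces the same expression.  Iterating the identity [k]
    times from [F_1] or [F_2] yields the formula, the coefficients being
    determined by a two-term recursion. *)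

Require Import Defs.
From HB Require Import structures.
From mathcomp Require Import all_boot all_order all_algebra.
From mathcomp Require Import complex ring lra zify.
From mathcomp Require Import all_classical all_reals all_analysis.
From mathcomp Require Import measurable_realfun.

Set Implicit Arguments.
Unset Strict Implicit.
Unset Printing Implicit Defensive.

Import Order.TTheory GRing.Theory Num.Theory.
Import numFieldNormedType.Exports.

Local Open Scope classical_set_scope.
Local Open Scope ring_scope.
Local Open Scope complex_scope.

(** * Completion of a measure *)

(** The hypotheses give no regularity of [f], only Lebesgue measurability, and this shapes the
    argument. Tonelli is applied to Borel product measures, so the real and imaginary parts of [f]
    are first replaced by Borel functions of the squared radius, chosen once from the
    one-dimensional hypothesis; null sets of squared radii lift to null sets in every positive
    dimension, so the same two functions serve for all n. The exchange of integrals is an instance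
    of Tonelli and hence needs nonnegative integrands. The factor s produced by differentiating
    under the integral must be dominated: the integral of |s| |G| in dimension n is 1/pi times that
    of |G| in dimension n + 1. A step from n to n + 2 thus draws on the dimension in between, so
    both parities of n enter each formula. The identity supplies only a first derivative of each
    F_n. Higher derivatives of F_1 and F_2 exist because the formula already reached can be solved
    for its highest derivative, whose coefficient is nonzero. *)

Section completion.
Context d (T : measurableType d) (R : realType).
Variable mu : {sigma_finite_measure set T -> \bar R}.
Local Notation outer := (measure_extension.mu_ext mu).
Let cT : measurableType _ := caratheodory_type outer.
Let cmu : {measure set cT -> \bar R} := @completed_measure_extension _ T R mu.

Lemma completion_measurable (A : set T) : measurable A -> measurable (A : set cT).
Proof. exact: caratheodory_measurable_mu_ext. Qed.

Lemma completion_measureE (A : set T) : measurable A -> cmu A = mu A.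
Proof. exact: measurable_mu_extE. Qed.

(** The outer measure is an infimum over countable measurable covers. Unions of covers within
    1/(n+1) of the infimum are intersected over n; if the infimum is infinite, the whole space
    works. *)
Lemma measurable_hull (X : set T) :
  exists B : set T, [/\ measurable B, X `<=` B & mu B = outer X].
Proof.
have [Xoo|] := boolP (outer X == +oo%E).
  exists setT; split => //.
  apply/eqP; rewrite eq_le (eqP Xoo) leey/= -(eqP Xoo) -(measurable_mu_extE mu)//.
  exact: le_mu_ext.
move=> Xoo.
have Xfin : outer X \is a fin_num.
  by rewrite ge0_fin_numE ?mu_ext_ge0// ltey.
have H n : exists A : set T, [/\ measurable A, X `<=` A &
    (mu A <= outer X + n.+1%:R^-1%:E)%E].
  have n0 : 0 < n.+1%:R^-1 :> R by [].
  have /(_ _ n0) [_ [A [mA XA] <-] Alt] := lb_ereal_inf_adherent _ Xfin.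
  exists (\bigcup_k A k); split => //; first exact: bigcupT_measurable.
  apply: le_trans (ltW Alt).
  apply: measure_sigma_subadditive => //; exact: bigcupT_measurable.
have [A HA] := choice H.
exists (\bigcap_n A n); split.
- by apply: bigcapT_measurable => n; have [] := HA n.
- by apply: sub_bigcap => n _; have [] := HA n.
apply/eqP; rewrite eq_le; apply/andP; split.
  apply/lee_addgt0Pr => /= _/posnumP[e]; near \oo => n.
  have [mA XA Ale] := HA n.
  apply: (@le_trans _ _ (mu (A n))).
    apply: le_measure; rewrite ?inE//; last exact: bigcap_inf.
    by apply: bigcapT_measurable => k; have [] := HA k.
  apply: (le_trans Ale); rewrite leeD// lee_fin ltW//.
  by near: n; apply: near_infty_natSinv_lt.
rewrite -(measurable_mu_extE mu); last first.
  by apply: bigcapT_measurable => k; have [] := HA k.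
by apply: le_mu_ext; apply: sub_bigcap => n _; have [] := HA n.
Unshelve. all: by end_near. Qed.

(** On a piece [F i] of finite measure, a hull of [E] exceeds it by a set of completed measure 0,
    since finite measures may be subtracted; a hull of that excess is the null set. Sigma-finiteness
    glues the pieces. *)
Lemma completion_measurable_set_ae (E : set cT) : measurable E ->
  exists B N : set T,
    [/\ measurable B, measurable N, mu N = 0 & E `\` N = B `\` N].
Proof.
move=> mE.
have [F TF FP] := sigma_finiteT mu.
have H i : exists BN : set T * set T,
    [/\ measurable BN.1, measurable BN.2, mu BN.2 = 0,
     E `&` F i `<=` BN.1 & BN.1 `\` (E `&` F i) `<=` BN.2].
  have [mF Foo] := FP i.
  have mEF : measurable (E `&` F i : set cT).
    by apply: measurableI => //; exact: completion_measurable.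
  have [B [mB EB muB]] := measurable_hull (E `&` F i).
  have EFoo : (outer (E `&` F i) < +oo)%E.
    apply: le_lt_trans (le_mu_ext mu (@subIsetr _ E (F i))) _.
    by rewrite (measurable_mu_extE mu).
  have [N [mN BN muN]] := measurable_hull (B `\` (E `&` F i)).
  exists (B, N); split => //=.
  rewrite muN.
  change (cmu (B `\` (E `&` F i)) = 0%E).
  have mB' : measurable (B : set cT) by exact: completion_measurable.
  rewrite measureD//; last by move: EFoo; rewrite -muB -(completion_measureE mB).
  rewrite setIidr//; change (cmu B - cmu (E `&` F i) = 0)%E.
  have -> : cmu B = cmu (E `&` F i) by rewrite completion_measureE.
  by rewrite subee// ge0_fin_numE//; exact: mu_ext_ge0.
have [BN HBN] := choice H.
exists (\bigcup_i (BN i).1), (\bigcup_i (BN i).2); split.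
- by apply: bigcupT_measurable => i; have [] := HBN i.
- by apply: bigcupT_measurable => i; have [] := HBN i.
- apply/eqP; rewrite eq_le measure_ge0 andbT.
  have -> : 0%E = (\sum_(i <oo) mu (BN i).2)%E.
    by rewrite eseries0// => i _ _; have [] := HBN i.
  apply: measure_sigma_subadditive => //.
  + by move=> i; have [] := HBN i.
  + by apply: bigcupT_measurable => i; have [] := HBN i.
apply/seteqP; split=> x [].
  move=> Ex Nx; split => //.
  have : [set: T] x by [].
  rewrite TF => -[i _ Fix]; exists i => //; have [_ _ _ + _] := HBN i; exact.
move=> [i _ Bix] Nx; split => //; apply: contrapT => nEx; apply: Nx.
by exists i => //; have [_ _ _ _] := HBN i; apply; split => // -[].
Qed.

(** The sublevel sets at rational heights determine [h] and are countably many, so their exceptional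
    null sets have a null union [N]; [h] is reset to 0 on [N]. *)
Lemma completion_measurable_fun_ae (h : T -> R) :
  measurable_fun setT (h : cT -> measurableTypeR R) ->
  exists (g : T -> R) (N : set T), [/\ measurable_fun setT g, measurable N,
    mu N = 0 & forall x, ~ N x -> h x = g x].
Proof.
move=> mh.
have H (q : rat) : exists BN : set T * set T, [/\ measurable BN.1, measurable BN.2,
    mu BN.2 = 0 & (h @^-1` `]-oo, ratr q[) `\` BN.2 = BN.1 `\` BN.2].
  have [|B [N []]] := @completion_measurable_set_ae (h @^-1` `]-oo, ratr q[).
    by rewrite -[X in measurable X]setTI; apply: mh => //; exact: measurable_itv.
  by exists (B, N).
have [BN HBN] := choice H.
(* An enumeration of the rationals; codes that represent no rational are sent to 0, which only
   repeats a set in the union. *)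
pose D n : rat := odflt 0 (unpickle n).
pose N := \bigcup_n (BN (D n)).2.
have mN : measurable N by apply: bigcupT_measurable => n; have [] := HBN (D n).
exists (fun x => if x \in N then 0 else h x), N; split => //.
- apply: (measurability _ (RGenInftyO.measurableE R)) => _ /= [_ [a ->] <-].
  (* Off [N], a value lies below [a] exactly when it lies below some rational [q <= a]. On [N] the
     new function is 0, so [N] is included as soon as such a [q] is positive. *)
  rewrite setTI (_ : _ @^-1` _ = \bigcup_(q : rat)
     (if ratr q <= a :> R then ((BN q).1 `\` N) `|` (if 0 < ratr q :> R then N else set0)
      else set0)).
    apply: bigcupT_measurable_rat => q; case: ifP => // _.
    have [mB _ _ _] := HBN q.
    by apply: measurableU; [exact: measurableD|case: ifP].
  have HB q x : ~ N x -> (BN q).1 x <-> h x < ratr q.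
    move=> nNx; have [_ _ _] := HBN q => /seteqP[H1 H2].
    have nx : ~ (BN q).2 x by move=> ?; apply: nNx; exists (pickle q) => //; rewrite /D pickleK.
    split => [Bx|hx]; first by have [] := H2 x (conj Bx nx); rewrite /= in_itv.
    by have [|//] := H1 x; split => //=; rewrite in_itv.
  apply/seteqP; split => x /=; rewrite in_itv/=.
    have [Nx|nNx] := pselect (N x).
      rewrite mem_set// => a0; have /rat_in_itvoo[q /itvP qa] := a0.
      by exists q => //=; rewrite qa; right; rewrite qa.
    rewrite memNset// => hxa; have /rat_in_itvoo[q /itvP qa] := hxa.
    exists q => //=; rewrite qa; left; split => //.
    by apply/HB => //; rewrite qa.
  case=> q _; case: ifPn => //= qa [[Bx nNx]|].
    by rewrite memNset// (lt_le_trans _ qa)//; apply/HB.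
  by case: ifPn => //= q0 Nx; rewrite mem_set// (lt_le_trans q0).
- apply/eqP; rewrite eq_le measure_ge0 andbT.
  have -> : 0%E = (\sum_(i <oo) mu (BN (D i)).2)%E.
    by rewrite eseries0// => i _ _; have [] := HBN (D i).
  apply: measure_sigma_subadditive => //.
  by move=> i; have [] := HBN (D i).
- by move=> x Nx; rewrite memNset.
Qed.

Lemma measurable_fun_completion d' (U : measurableType d') (g : T -> U) :
  measurable_fun setT g -> measurable_fun setT (g : cT -> U).
Proof.
by move=> mg _ Y mY; apply: completion_measurable; exact: mg.
Qed.

Lemma ge0_integral_completion (g : T -> \bar R) :
  measurable_fun setT g -> (forall x, 0 <= g x)%E ->
  (\int[cmu]_x g x = \int[mu]_x g x)%E.
Proof.
move=> mg g0.
pose i : cT -> T := id.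
have mi : measurable_fun setT i by move=> _ Y mY; apply: completion_measurable; rewrite setTI.
have := @ge0_integral_pushforward _ _ _ _ R i mi cmu setT g measurableT mg (fun x _ => g0 x).
rewrite preimage_setT => <-.
by apply: eq_measure_integral => A mA _; exact: completion_measureE.
Qed.

(** The bridge from integrals against [lebesgue_tuple] to integrals against the Borel product
    measure, on which Tonelli is available. *)
Lemma integral_completion_ae (phi : cT -> \bar R) (psi : T -> \bar R) (Z : set T) :
  measurable_fun setT phi -> measurable_fun setT psi ->
  measurable Z -> mu Z = 0%E -> (forall x, ~ Z x -> phi x = psi x) ->
  (\int[cmu]_x phi x = \int[mu]_x psi x)%E.
Proof.
move=> mphi mpsi mZ Z0 e.
have mpsi' : measurable_fun setT (psi : cT -> \bar R) by exact: measurable_fun_completion.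
transitivity (\int[cmu]_x psi x)%E.
  apply: ae_eq_integral => //.
  exists Z; split; first exact: completion_measurable.
    by rewrite -Z0; exact: completion_measureE.
  by move=> x /= H; apply: contrapT => nZ; apply: H => _; exact: e.
rewrite integralE [RHS]integralE; congr (_ - _)%E.
- by apply: ge0_integral_completion => //; exact: measurable_funepos.
- by apply: ge0_integral_completion => //; exact: measurable_funeneg.
Qed.

End completion.

(** * Quadratic changes of variables *)

Section pushforward_cdf.
Context d (T : measurableType d) (R : realType).
Variable m : {measure set T -> \bar R}.
Variables (q : T -> R) (c : {nonneg R}).
Hypothesis mq : measurable_fun setT (q : T -> measurableTypeR R).
Hypothesis cdf : forall v : R, 0 <= v -> m (q @^-1` `[0, v[) = (c%:num * v)%:E.

(* The points where [q] is negative are left out, so that a restriction of the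
   domain can be encoded in [q]. *)
Lemma ge0_integral_comp_cdf (h : R -> \bar R) :
  measurable_fun setT h -> (forall u, 0 <= h u)%E ->
  (\int[m]_(x in q @^-1` `[0%R, +oo[) h (q x) =
   c%:num%:E * \int[lebesgue_measure]_(u in `[0%R, +oo[) h u)%E.
Proof.
move=> mh h0.
pose mq' := isMeasurableFun.Build _ _ T (measurableTypeR R) q mq.
pose Q : {mfun T >-> measurableTypeR R} := HB.pack q mq'.
have mh0 : measurable_fun (`[0, +oo[ : set R) h by exact: measurable_funTS.
have m0y : measurable (`[0, +oo[%classic : set (measurableTypeR R)).
  exact: measurable_itv.
rewrite -ge0_integral_mscale //.
rewrite -[LHS](@ge0_integral_pushforward _ _ _ _ R Q mq m `[0, +oo[ h) //.
apply: (eq_measure_integral (mscale c lebesgue_measure)) => A mA A0y.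
suff : mrestr (pushforward m Q) m0y A = mrestr (mscale c lebesgue_measure) m0y A.
  by rewrite /mrestr setIidl.
have E (a : R) : `]-oo, a[%classic `&` `[0, +oo[%classic = `[0, a[%classic :> set R.
  by apply/seteqP; split=> x /=; rewrite !in_itv/= andbT andbC => /andP.
have mE a : mrestr (pushforward m Q) m0y `]-oo, a[%classic = (c%:num * Num.max 0 a)%:E.
  change (m (q @^-1` (`]-oo, a[%classic `&` `[0, +oo[%classic))
    = (c%:num * Num.max 0 a)%:E); rewrite E.
  have [a0|a0] := leP 0 a; first by rewrite cdf// max_r.
  by rewrite set_itv_ge ?bnd_simp -?leNgt ?ltW// preimage_set0 measure0 mulr0.
(* The rays []-oo, a[] are stable under intersection and generate the Borel sets; after restriction
   to [[0, +oo[] both measures give them mass [c * max 0 a]. *)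
apply: (@measure_unique _ R (measurableTypeR R) (@RGenInftyO.G R)
  (fun n => `]-oo, n%:R[%classic)) => //.
- exact: (RGenInftyO.measurableE R).
- move=> _ _ [a ->] [b ->]; exists (Num.min a b).
  by apply/seteqP; split => x /=; rewrite !in_itv/= lt_min => /andP.
- by move=> n; exists n%:R.
- apply/seteqP; split => // x _.
  by exists (Num.truncn x).+1 => //=; rewrite in_itv/= Num.Theory.truncnS_gt.
- move=> _ [a ->]; rewrite [LHS]mE.
  change ((c%:num * Num.max 0 a)%:E = c%:num%:E * lebesgue_measure
   (`]-oo, a[%classic `&` `[0%R, +oo[%classic : set R))%E.
  rewrite E lebesgue_measure_itv/= lte_fin; case: ltP => a0.
    by rewrite oppr0 addr0 EFinM.
  by rewrite mule0 mulr0.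
- by move=> n; rewrite [ltLHS]mE ltry.
Qed.

End pushforward_cdf.

Section lebesgue_square.
Context (R : realType).
Local Notation mu := (@lebesgue_measure R).

Lemma ge0_integral_oppr (f : R -> \bar R) : measurable_fun setT f ->
  (forall x, 0 <= f x)%E -> (\int[mu]_x f (- x)%R = \int[mu]_x f x)%E.
Proof.
move=> mf f0.
rewrite -[LHS](@ge0_integral_pushforward _ _ (measurableTypeR R)
  (measurableTypeR R) R -%R _ mu setT f)//.
by apply: eq_measure_integral => //= A mA _; exact: lebesgue_measureN.
Qed.

Lemma integral_lin0 (r : R) : 0 <= r ->
  (\int[mu]_(s in `[0%R, r]) (2 * s)%:E = (r ^+ 2)%:E)%E.
Proof.
rewrite le_eqVlt => /predU1P[<-|r0].
  by rewrite set_itv1 integral_set1 expr0n.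
rewrite (@continuous_FTC2 _ _ (fun s => s ^+ 2)) //.
- by rewrite expr0n sube0.
- apply: continuous_subspaceT => x; apply: cvgM; [exact: cvg_cst|exact: cvg_id].
- split.
  + by move=> x _; exact: exprn_derivable.
  + by apply: cvg_at_right_filter; exact: exprn_continuous.
  + by apply: cvg_at_left_filter; exact: exprn_continuous.
- by move=> x _; rewrite derive1E exp_derive /= expr1 scaler1 /GRing.scale/= mulr_natl.
Qed.

(** As [h] is merely measurable, the substitution u = s^2 is obtained as an equality of measures,
    through [ge0_integral_comp_cdf], and not from primitives. *)
Lemma ge0_integral_sqr_half (h : R -> \bar R) : measurable_fun setT h ->
  (forall u, 0 <= h u)%E ->
  (\int[mu]_s ((Num.max 0 (2 * s))%:E * h (s ^+ 2)%R) =
   \int[mu]_(u in `[0%R, +oo[) h u)%E.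
Proof.
move=> mh h0.
(* The weight [2 s] is the length of the section at [s] of the planar region [D],
   and [(s, t) |-> s ^+ 2] maps the area of [D] to the Lebesgue measure. *)
pose D := [set p : R * R | 0 <= p.2 <= 2 * p.1].
pose q := fun p : R * R => if 0 <= p.2 <= 2 * p.1 then p.1 ^+ 2 else -1.
have mb : measurable_fun setT (fun p : R * R => 0 <= p.2 <= 2 * p.1).
  apply: measurable_and; apply: measurable_fun_ler => //.
  exact: measurable_funM.
have mq : measurable_fun setT (q : R * R -> measurableTypeR R).
  by apply: measurable_fun_ifT => //; exact: measurable_funX.
have qD : q @^-1` `[0, +oo[ = D.
  apply/seteqP; split => p; rewrite /q/D/= in_itv/= andbT; case: ifP => //.
    by rewrite lerNr oppr0 ler10.
  by rewrite sqr_ge0.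
have cdf v : 0 <= v -> (mu \x mu)%E (q @^-1` `[0, v[) = (1%:nng%:num * v)%:E.
  move=> v0; rewrite /product_measure1/= mul1r.
  transitivity (\int[mu]_(s in `[0%R, Num.sqrt v]) (2 * s)%:E)%E; last first.
    by rewrite integral_lin0 ?sqrtr_ge0// sqr_sqrtr.
  rewrite -integral_itv_bndo_bndc; last first.
    by apply/measurable_EFinP; exact: measurable_funM.
  rewrite [RHS]integral_mkcond; apply: eq_integral => s _.
  rewrite patchE; case: ifPn.
    rewrite inE/= in_itv/= => /andP[s0 sv].
    rewrite (_ : xsection _ _ = `[0, 2 * s]%classic).
      rewrite lebesgue_measure_itv/= lte_fin; case: ltP => [_|s0'].
        by rewrite -EFinB subr0.
      by congr EFin; apply/le_anti; rewrite s0' mulr_ge0.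
    apply/seteqP; split => t; rewrite /xsection/= inE/= /q in_itv/=.
      by case: ifP => //= _; rewrite in_itv/= lerNr oppr0 ler10.
    move=> ->; rewrite in_itv/= sqr_ge0/=.
    by rewrite -(sqr_sqrtr v0) ltr_pXn2r// nnegrE sqrtr_ge0.
  rewrite notin_setE/= in_itv/= => sv.
  rewrite (_ : xsection _ _ = set0) ?measure0//.
  apply/seteqP; split => t //; rewrite /xsection/= inE/= /q in_itv/=.
  case: ifP => [st|_]; last by rewrite lerNr oppr0 ler10.
  rewrite sqr_ge0/= => sv'; apply: sv.
  have s0 : 0 <= s by lra.
  by rewrite s0/= -(ltr_pXn2r (_ : 0 < 2)%N) ?nnegrE ?sqrtr_ge0// sqr_sqrtr.
have := @ge0_integral_comp_cdf _ (measurableTypeR R * measurableTypeR R)%type R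
  (mu \x mu)%E q 1%:nng mq cdf h mh h0.
rewrite mul1e => <-; rewrite qD integral_mkcond.
have mD : measurable (D : set (measurableTypeR R * measurableTypeR R)%type).
  rewrite -qD -[X in measurable X]setTI.
  by apply: mq => //; exact: measurable_itv.
rewrite fubini_tonelli1; last 2 first.
- apply/(measurable_restrictT _ _).1 => //.
  by apply: measurable_funTS; exact: measurableT_comp mh mq.
- by move=> x; rewrite patchE; case: ifP.
apply: eq_integral => s _; rewrite /fubini_F.
transitivity (\int[mu]_(t in `[0%R, (2 * s)%R]) h (s ^+ 2)%R)%E.
  rewrite integral_cst//= lebesgue_measure_itv/= lte_fin maxC muleC.
  congr (_ * _)%E; rewrite maxC; case: (ltP 0 (2 * s)) => s0 //.
  by rewrite oppr0 addr0.
rewrite [LHS]integral_mkcond; apply: eq_integral => t _.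
rewrite !patchE; case: ifPn.
  rewrite inE/= in_itv/= => st; rewrite mem_set//= /q st//.
by rewrite notin_setE/= in_itv/= => st; rewrite memNset.
Qed.

Lemma ge0_integral_sqr (h : R -> \bar R) : measurable_fun setT h ->
  (forall u, 0 <= h u)%E ->
  (\int[mu]_s (`|s|%:E * h (s ^+ 2)%R) = \int[mu]_(u in `[0%R, +oo[) h u)%E.
Proof.
move=> mh h0.
(* Half of the one-sided weight: [g s + g (- s)] is the integrand with weight [|s|], and each
   summand contributes half of the right-hand side. *)
pose g (s : R) := ((Num.max 0 (2 * s))%:E * (2^-1%:E * h (s ^+ 2)%R))%E.
have mh2 : measurable_fun setT (fun u => 2^-1%:E * h u)%E.
  exact: measurable_funeM.
have h20 u : (0 <= 2^-1%:E * h u)%E by rewrite mule_ge0.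
have mg : measurable_fun setT g.
  apply: emeasurable_funM.
    by apply/measurable_EFinP; exact: measurable_maxr.
  by apply: (measurableT_comp mh2); exact: measurable_funX.
have g0 s : (0 <= g s)%E.
  by rewrite /g mule_ge0// lee_fin le_max lexx.
transitivity (\int[mu]_s (g s + g (- s)%R))%E.
  apply: eq_integral => s _; rewrite /g sqrrN -ge0_muleDl; last 2 first.
  - by rewrite lee_fin le_max lexx.
  - by rewrite lee_fin le_max lexx.
  rewrite muleA -EFinD -EFinM; congr (_%:E * _)%E.
  case: (leP 0 s) => s0.
    by rewrite ger0_norm// max_r ?max_l; lra.
  by rewrite ltr0_norm// max_l ?max_r; lra.
rewrite ge0_integralD//; last by apply: measurableT_comp => //.
rewrite ge0_integral_oppr// (ge0_integral_sqr_half mh2 h20).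
rewrite -ge0_integralD//; [|exact: measurable_funTS..].
apply: eq_integral => u _; rewrite -ge0_muleDl//.
by rewrite -EFinD (_ : 2^-1 + 2^-1 = 1) ?mul1e//; lra.
Qed.

(** The area of a disc computed from its chords, by the substitution a = r sin t. *)
Lemma integral_half_disc (r : R) : 0 < r ->
  (\int[mu]_(a in `[(- r)%R, r]) (2 * Num.sqrt (r ^+ 2 - a ^+ 2))%:E =
  (pi * r ^+ 2)%:E)%E.
Proof.
move=> r0.
pose F (t : R) := r * sin t.
have pi0 : 0 < pi / 2 :> R by rewrite divr_gt0// pi_gt0.
have dF (x : R) : is_derive x 1 F (r * cos x) by exact: is_deriveZ.
have F1 : (derive1 F) = (fun x => r * cos x).
  by apply/funext => x; rewrite derive1E; exact: derive_val.
have cF1 : continuous (derive1 F).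
  rewrite F1 => x; apply: cvgM; [exact: cvg_cst|exact: continuous_cos].
have cF : continuous F.
  by move=> x; apply: cvgM; [exact: cvg_cst|exact: continuous_sin].
pose G a := 2 * Num.sqrt (r ^+ 2 - a ^+ 2).
have cG : continuous G.
  move=> x; apply: cvgM; first exact: cvg_cst.
  apply: continuous_comp; last exact: sqrt_continuous.
  by apply: cvgB; [exact: cvg_cst|exact: exprn_continuous].
have := @integration_by_substitution_increasing _ F G (- (pi / 2)) (pi / 2).
have -> : F (- (pi / 2)) = - r by rewrite /F sinN sin_pihalf mulrN1.
have -> : F (pi / 2) = r by rewrite /F sin_pihalf mulr1.
rewrite F1 in cF1 *; move=> ->; first last.
- exact: continuous_subspaceT.
- split.
  + by move=> x _; apply: ex_derive.
  + by apply: cvg_at_right_filter; exact: cF.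
  + by apply: cvg_at_left_filter; exact: cF.
- by apply/cvg_ex; eexists; apply: cvg_at_left_filter; exact: cF1.
- by apply/cvg_ex; eexists; apply: cvg_at_right_filter; exact: cF1.
- by move=> x _; exact: cF1.
- by move=> x y xI yI xy; rewrite /F ltr_pM2l// ltr_sin.
- lra.
transitivity (\int[mu]_(x in `[(- (pi / 2))%R, (pi / 2)%R]) (2 * r ^+ 2 * cos x ^+ 2)%:E)%E.
  apply: eq_integral => x; rewrite inE/= in_itv/= => /andP[x1 x2]; congr EFin.
  rewrite fctE/= /G /F exprMn -{1}(mulr1 (r ^+ 2)) -mulrBr.
  rewrite -(cos2Dsin2 x) addrK sqrtrM ?sqr_ge0// !sqrtr_sqr.
  have cx : 0 <= cos x by apply: cos_ge0_pihalf; rewrite x1.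
  by rewrite (ger0_norm cx) (ger0_norm (ltW r0)); ring.
(* A primitive of [2 * r ^+ 2 * cos x ^+ 2], because 1 + cos^2 - sin^2 = 2 cos^2. *)
pose H x := r ^+ 2 * (x + sin x * cos x).
have dH (x : R) : is_derive x 1 H (2 * r ^+ 2 * cos x ^+ 2).
  rewrite /H; apply: is_derive_eq.
  rewrite /GRing.scale/=.
  have := cos2Dsin2 x; move: (cos x) (sin x) => c' s' e.
  by rewrite (_ : 1 + _ = 2 * c' ^+ 2); [ring|lra].
have cH : continuous H.
  by move=> x; apply: differentiable_continuous; apply/derivable1_diffP; apply: ex_derive.
rewrite (@continuous_FTC2 _ _ H) //.
- rewrite /H sinN cosN cos_pihalf sin_pihalf -EFinB; congr EFin.
  by field.
- lra.
- apply: continuous_subspaceT => x; apply: cvgM; first exact: cvg_cst.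
  by apply: (@continuous_comp _ _ _ cos (fun y => y ^+ 2));
    [exact: continuous_cos|exact: exprn_continuous].
- split.
  + by move=> x _; apply: ex_derive.
  + by apply: cvg_at_right_filter; exact: cH.
  + by apply: cvg_at_left_filter; exact: cH.
- by move=> x _; rewrite derive1E; exact: derive_val.
Qed.


Lemma ge0_integral_sqr2 (h : R -> \bar R) : measurable_fun setT h ->
  (forall u, 0 <= h u)%E ->
  (\int[mu]_a \int[mu]_b h (a ^+ 2 + b ^+ 2)%R =
   pi%:E * \int[mu]_(u in `[0%R, +oo[) h u)%E.
Proof.
move=> mh h0.
pose q (p : R * R) := p.1 ^+ 2 + p.2 ^+ 2.
have mq : measurable_fun setT (q : R * R -> measurableTypeR R).
  by apply: measurable_funD; apply: measurable_funX.
have qT : q @^-1` `[0, +oo[ = setT.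
  by apply/seteqP; split => // p _; rewrite /q/= in_itv/= andbT addr_ge0 ?sqr_ge0.
have pige0 : 0 <= pi :> R by exact: pi_ge0.
have cdf v : 0 <= v -> (mu \x mu)%E (q @^-1` `[0, v[) = ((NngNum pige0)%:num * v)%:E.
  rewrite le_eqVlt => /predU1P[<-|v0].
    by rewrite set_itvco0 preimage_set0 measure0 mulr0.
  rewrite /product_measure1/=.
  pose r := Num.sqrt v.
  have r0 : 0 < r by rewrite sqrtr_gt0.
  rewrite -[in RHS](sqr_sqrtr (ltW v0)) -/r -integral_half_disc// [RHS]integral_mkcond.
  apply: eq_integral => a _.
  pose w := Num.sqrt (r ^+ 2 - a ^+ 2).
  rewrite (_ : xsection _ _ = `]- w, w[%classic); last first.
    apply/seteqP; split => t; rewrite /xsection/= inE/= /q/= !in_itv/= -ltr_norml.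
      move=> /andP[_ atv]; have tw : t ^+ 2 < r ^+ 2 - a ^+ 2.
        by rewrite ltrBrDl sqr_sqrtr// ltW.
      by rewrite -sqrtr_sqr ltr_sqrt// (le_lt_trans _ tw)// sqr_ge0.
    rewrite addr_ge0 ?sqr_ge0//= => tw.
    have w0 : 0 < r ^+ 2 - a ^+ 2 by rewrite -sqrtr_gt0 (le_lt_trans _ tw).
    move: tw; rewrite -sqrtr_sqr ltr_sqrt// ltrBrDl => /lt_le_trans; apply.
    by rewrite sqr_sqrtr// ltW.
  rewrite lebesgue_measure_itv/= lte_fin -EFinB opprK patchE.
  have w0 : 0 <= w by exact: sqrtr_ge0.
  case: (boolP (a \in `[- r, r]%classic)) => [_|].
    rewrite /= -/w; case: (ltP (- w) w) => ww; first by congr EFin; ring.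
    by congr EFin; lra.
  rewrite notin_setE/= in_itv/= -ler_norml => /negP; rewrite -ltNge => ra.
  (* For [|a| > r] the root is taken of a negative number, where [Num.sqrt] is 0, so the section is
     empty. *)
  have -> : w = 0; last by rewrite oppr0 ltxx.
  rewrite /w ler0_sqrtr// subr_le0 -(real_normK (num_real a)).
  by rewrite ler_pXn2r ?nnegrE// ltW.
have := @ge0_integral_comp_cdf _ (measurableTypeR R * measurableTypeR R)%type R
  (mu \x mu)%E q (NngNum pige0) mq cdf h mh h0.
rewrite qT => <-; rewrite fubini_tonelli1//.
exact: measurableT_comp.
Qed.

End lebesgue_square.

Section three_variables.
Context (R : realType).
Local Notation mu := (@lebesgue_measure R).

Lemma ge0_integral_shift (c : R) (f : R -> \bar R) : measurable_fun setT f ->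
  (forall x, 0 <= f x)%E ->
  (\int[mu]_(u in `[0%R, +oo[) f (c + u)%R = \int[mu]_(v in `[c, +oo[) f v)%E.
Proof.
move=> mf f0.
have mD : measurable_fun setT (+%R c : measurableTypeR R -> measurableTypeR R).
  exact: measurable_funD.
pose mQ := isMeasurableFun.Build _ _ (measurableTypeR R) (measurableTypeR R) (+%R c) mD.
pose Q : {mfun measurableTypeR R >-> measurableTypeR R} := HB.pack (+%R c) mQ.
rewrite (_ : `[0, +oo[%classic = (+%R c) @^-1` `[c, +oo[%classic); last first.
  by apply/seteqP; split => x /=; rewrite !in_itv/= !andbT lerDl.
rewrite -[LHS](@ge0_integral_pushforward _ _ (measurableTypeR R)
  (measurableTypeR R) R Q _ mu _ f)//; last exact: measurable_funTS.
apply: eq_measure_integral => A mA _; apply/esym.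
apply: (@lebesgue_measure_unique R (pushforward mu Q)) => //= _ [[a b]] _ <-.
rewrite /pushforward/= (_ : _ @^-1` _ = `](a - c), (b - c)]%classic); last first.
  by apply/seteqP; split => x /=; rewrite !in_itv/= ltrBlDl lerBrDl.
rewrite !lebesgue_measure_itv/= !lte_fin ltrD2r.
by case: ifP => // _; rewrite -!EFinB; congr EFin; ring.
Qed.

Section odd_primitive.
Variables phi Psi : R -> R.
Hypothesis cphi : continuous phi.
Hypothesis phi0 : forall s, 0 <= phi s.
Hypothesis dPsi : forall s : R, is_derive s 1 Psi (phi s).
Hypothesis oPsi : forall s, Psi (- s) = - Psi s.

Lemma primitive_continuous : continuous Psi.
Proof.
by move=> x; apply: differentiable_continuous; apply/derivable1_diffP; apply: ex_derive.
Qed.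

(** Oddness turns [Psi r - Psi (- r)] into [2 * Psi r]. The pairs used later are 1 with s, and 1 +
    cos(a s) with s + sin(a s)/a. *)
Lemma integral_odd_primitive (r : R) : 0 <= r ->
  (\int[mu]_(s in `[(- r)%R, r]) (phi s)%:E = (2 * Psi r)%:E)%E.
Proof.
rewrite le_eqVlt => /predU1P[<-|r0].
  by rewrite oppr0 set_itv1 integral_set1; congr EFin; have := oPsi 0; rewrite oppr0; lra.
rewrite (@continuous_FTC2 _ _ Psi) //.
- by rewrite oPsi -EFinB; congr EFin; ring.
- lra.
- exact: continuous_subspaceT.
- split.
  + by move=> x _; apply: ex_derive.
  + by apply: cvg_at_right_filter; exact: primitive_continuous.
  + by apply: cvg_at_left_filter; exact: primitive_continuous.
- by move=> x _; rewrite derive1E; exact: derive_val.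
Qed.

Lemma odd_primitive_ge0 (r : R) : 0 <= r -> 0 <= Psi r.
Proof.
move=> r0; have : 0 <= 2 * Psi r; last by rewrite pmulr_rge0.
by rewrite -lee_fin -integral_odd_primitive//; apply: integral_ge0 => s _; rewrite lee_fin.
Qed.

Lemma mul_odd_primitive_norm (s : R) : `|s| * Psi `|s| = s * Psi s.
Proof. by case: (ger0P s) => // _; rewrite oPsi mulrNN. Qed.

Lemma mul_odd_primitive_ge0 (s : R) : 0 <= s * Psi s.
Proof. by rewrite -mul_odd_primitive_norm mulr_ge0// odd_primitive_ge0. Qed.

(* The tail integral of [h] over [[s ^+ 2, +oo[] is exchanged with the integral of
   [phi], which stands for an integration by parts and needs no regularity of [h]. *)
Lemma ge0_integral_sqr3 (h : R -> \bar R) :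
  measurable_fun setT h -> (forall u, 0 <= h u)%E ->
  (\int[mu]_s ((phi s)%:E * \int[mu]_a \int[mu]_b h (s ^+ 2 + (a ^+ 2 + b ^+ 2))%R) =
   (2 * pi)%:E * \int[mu]_s ((s * Psi s)%:E * h (s ^+ 2)%R))%E.
Proof.
move=> mh h0.
(* The kernel on the planar region s^2 <= v. Integrating in v first gives the tail integral of [h];
   integrating in s first gives [phi] over [-sqrt v, sqrt v], that is [2 * Psi (sqrt v)]. *)
pose k (p : R * R) := ((phi p.1)%:E * (if (p.1 ^+ 2 <= p.2)%R then h p.2 else 0))%E.
have mk : measurable_fun setT k.
  apply: emeasurable_funM.
    by apply/measurable_EFinP; apply: measurableT_comp => //; exact: continuous_measurable_fun.
  apply: measurable_fun_ifT => //; last exact: measurableT_comp.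
  by apply: measurable_fun_ler => //; exact: measurable_funX.
have k0 p : (0 <= k p)%E.
  by rewrite /k mule_ge0 ?lee_fin//; case: ifP.
transitivity (pi%:E * \int[mu]_s \int[mu]_v k (s, v))%E.
  rewrite -ge0_integralZl//; last 3 first.
  - exact: (@measurable_fun_fubini_tonelli_F _ _ (measurableTypeR R) (measurableTypeR R) R mu k).
  - by move=> s _; exact: integral_ge0.
  - exact: pi_ge0.
  apply: eq_integral => s _.
  rewrite (@ge0_integral_sqr2 _ (fun u => h (s ^+ 2 + u)))//; last first.
    by apply: measurableT_comp => //; exact: measurable_funD.
  rewrite ge0_integral_shift// muleCA; congr (_ * _)%E.
  rewrite /k/= ge0_integralZl//; first last.
  - by rewrite lee_fin.
  - by move=> v _; case: ifP.
  - by apply: measurable_fun_ifT => //; exact: measurable_fun_ler.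
  congr (_ * _)%E; rewrite [LHS]integral_mkcond; apply: eq_integral => v _.
  by rewrite patchE mem_setE in_itv/= andbT.
rewrite (@fubini_tonelli _ _ (measurableTypeR R) (measurableTypeR R) R mu mu k)//.
pose h' (v : R) := (h v * (2 * Psi (Num.sqrt v))%:E)%E.
transitivity (pi%:E * \int[mu]_(v in `[0%R, +oo[) h' v)%E.
  congr (_ * _)%E; rewrite [RHS]integral_mkcond; apply: eq_integral => v _.
  rewrite patchE mem_setE in_itv/= andbT; case: ifPn => v0; last first.
    rewrite integral0_eq// => s _; rewrite /k/= ifN ?mule0//.
    by apply: contra v0 => /(le_trans (sqr_ge0 _)).
  rewrite /h' -integral_odd_primitive ?sqrtr_ge0// -ge0_integralZl//; first last.
  - by move=> s _; rewrite lee_fin.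
  - apply/measurable_EFinP; apply: measurable_funTS; exact: continuous_measurable_fun.
  rewrite [RHS]integral_mkcond; apply: eq_integral => s _.
  rewrite patchE mem_setE in_itv/= -ler_norml /k/= muleC.
  rewrite (_ : (s ^+ 2 <= v) = (`|s| <= Num.sqrt v)); last first.
    by rewrite -sqrtr_sqr ler_sqrt ?sqr_ge0.
  by case: ifP => //; rewrite mul0e.
(* The substitution v = s^2 is run backwards; its weight [|s|] combines with [Psi |s|] into
   [s * Psi s], both factors being odd. *)
rewrite -ge0_integral_sqr; last 2 first.
- apply: emeasurable_funM => //; apply/measurable_EFinP; apply: measurable_funM => //.
  apply: measurableT_comp; first exact: (continuous_measurable_fun primitive_continuous).
  by apply: continuous_measurable_fun => x; exact: sqrt_continuous.
- by move=> v; rewrite /h' mule_ge0// lee_fin mulr_ge0// odd_primitive_ge0// sqrtr_ge0.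
have mh2 : measurable_fun setT (fun s : R => h (s ^+ 2)).
  by apply: measurableT_comp => //; exact: measurable_funX.
rewrite (mulrC 2) EFinM -[RHS]muleA -[X in (_ = _ * X)%E]ge0_integralZl//; first last.
- by move=> s _; rewrite mule_ge0// lee_fin mul_odd_primitive_ge0.
- apply: emeasurable_funM => //; apply/measurable_EFinP; apply: measurable_funM => //.
  exact: (continuous_measurable_fun primitive_continuous).
congr (_ * _)%E; apply: eq_integral => s _.
rewrite /h' muleCA -EFinM sqrtr_sqr muleA -EFinM muleC; congr (_%:E * _)%E.
by rewrite -mul_odd_primitive_norm; ring.
Qed.

End odd_primitive.

End three_variables.

(** * Integrals of radial functions over R^n *)

Section tuple_integral.
Context (R : realType).
Local Notation mu := (@lebesgue_measure R).
Local Notation rT := (measurableTypeR R).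
Local Notation bl := (borel_lebesgue R).

Lemma dotp_tcons n (s : R) (y : n.-tuple R) :
  dotp (tcons (s, y)) (tcons (s, y)) = s ^+ 2 + dotp y y.
Proof.
rewrite /dotp big_ord_recl/=; congr (_ + _).
by apply: eq_bigr => i _; rewrite !(tnth_nth 0)/=.
Qed.

Lemma dotp_ge0 n (x : n.-tuple R) : 0 <= dotp x x.
Proof. by apply: sumr_ge0 => i _; rewrite -expr2 sqr_ge0. Qed.

Lemma measurable_dotp n :
  measurable_fun setT (fun x : n.-tuple rT => dotp x x : rT).
Proof.
apply: measurable_sum => i; apply: measurable_funM; exact: measurable_tnth.
Qed.

Lemma measurable_thead n : measurable_fun setT (@thead n rT).
Proof. exact: measurable_tnth. Qed.

Section tonelli.
Variables (n : nat) (F : R -> R -> \bar R).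
Hypothesis mF : measurable_fun setT (fun p : rT * rT => F p.1 p.2).
Hypothesis F0 : forall s u, (0 <= F s u)%E.

Let f (p : rT * n.-tuple rT) := F p.1 (p.1 ^+ 2 + dotp p.2 p.2).

Let mf : measurable_fun setT f.
Proof.
apply: (@measurableT_comp _ _ _ _ _ _ (fun p : rT * rT => F p.1 p.2) _
   (fun p : rT * n.-tuple rT => (p.1, p.1 ^+ 2 + dotp p.2 p.2))) => //.
apply: measurable_fun_pair => //.
apply: measurable_funD; first exact: measurable_funX.
exact: (measurableT_comp (@measurable_dotp n) measurable_snd).
Qed.

Let f0 p : (0 <= f p)%E. Proof. exact: F0. Qed.

Lemma integral_borel_lebesgueS :
  (\int[bl n.+1]_x F (thead x) (dotp x x) = \int[mu \x bl n]_p f p)%E.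
Proof.
pose g (x : n.+1.-tuple rT) := F (thead x) (dotp x x).
have mg : measurable_fun setT g.
  apply: (@measurableT_comp _ _ _ _ _ _ (fun p : rT * rT => F p.1 p.2) _
   (fun x : n.+1.-tuple rT => (thead x, dotp x x))) => //.
  apply: measurable_fun_pair; [exact: measurable_thead|exact: measurable_dotp].
have := @ge0_integral_pushforward _ _ _ _ R (@tcons rT n) (@measurable_tcons _ rT n)
   (mu \x bl n)%E setT g measurableT mg (fun x _ => F0 _ _).
rewrite preimage_setT => e.
transitivity (\int[mu \x bl n]_x (g \o (@tcons rT n)) x)%E; first exact: e.
apply: eq_integral => -[s y] _; rewrite /g/= /f/=.
by rewrite (dotp_tcons s y).
Qed.

Lemma ge0_integral_tcons1 :
  (\int[bl n.+1]_x F (thead x) (dotp x x) =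
   \int[mu]_s \int[bl n]_y F s (s ^+ 2 + dotp y y)%R)%E.
Proof. by rewrite integral_borel_lebesgueS; exact: (fubini_tonelli1 f). Qed.

Lemma ge0_integral_tcons2 :
  (\int[bl n.+1]_x F (thead x) (dotp x x) =
   \int[bl n]_y \int[mu]_s F s (s ^+ 2 + dotp y y)%R)%E.
Proof. by rewrite integral_borel_lebesgueS; exact: (fubini_tonelli2 f). Qed.

End tonelli.

Lemma ge0_integral_tconsS n (h : R -> \bar R) : measurable_fun setT h ->
  (forall u, 0 <= h u)%E ->
  (\int[bl n.+1]_x h (dotp x x) =
   \int[bl n]_y \int[mu]_s h (s ^+ 2 + dotp y y)%R)%E.
Proof.
move=> mh h0; rewrite (@ge0_integral_tcons2 n (fun _ => h))//.
exact: measurableT_comp.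
Qed.

(** The double integral equals pi times the integral of h(v + u) over u >= 0, a single parameter
    integral whose measurability in v comes with Tonelli. *)
Lemma measurable_integral_sqr2 (h : R -> \bar R) : measurable_fun setT h ->
  (forall u, 0 <= h u)%E ->
  measurable_fun setT
    (fun v : R => \int[mu]_a \int[mu]_b h (v + (a ^+ 2 + b ^+ 2))%R)%E.
Proof.
move=> mh h0.
under eq_fun => v.
  rewrite (@ge0_integral_sqr2 _ (fun u => h (v + u)%R))//; last first.
    by apply: measurableT_comp => //; exact: measurable_funD.
  over.
apply: measurable_funeM.
pose f (p : rT * rT) := if 0 <= p.2 then h (p.1 + p.2) else 0%E.
have mf : measurable_fun setT f.
  apply: measurable_fun_ifT => //; first exact: measurable_fun_ler.
  by apply: measurableT_comp => //; exact: measurable_funD.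
have f0 p : (0 <= f p)%E by rewrite /f; case: ifP.
rewrite (_ : (fun _ => _) = fun v => (\int[mu]_u f (v, u))%E).
  exact: (@measurable_fun_fubini_tonelli_F _ _ rT rT R mu f).
apply/funext => v; rewrite [LHS]integral_mkcond; apply: eq_integral => u _.
by rewrite patchE mem_setE in_itv/= andbT.
Qed.

Lemma measurable_comp_dotp n (h : R -> \bar R) (v : R) : measurable_fun setT h ->
  measurable_fun setT (fun y : n.-tuple rT => h (v + dotp y y)).
Proof.
move=> mh; apply: measurableT_comp => //.
by apply: measurable_funD => //; exact: measurable_dotp.
Qed.

(** The offset [v] holds the square of a coordinate that has already been split off. *)
Lemma ge0_integral_tconsSS n (h : R -> \bar R) (v : R) : measurable_fun setT h ->
  (forall u, 0 <= h u)%E ->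
  (\int[bl n.+2]_x h (v + dotp x x)%R =
   \int[bl n]_y \int[mu]_a \int[mu]_b h ((v + dotp y y) + (a ^+ 2 + b ^+ 2))%R)%E.
Proof.
move=> mh h0.
pose g (p : rT * rT) := h (v + (p.2 ^+ 2 + p.1)).
have mg : measurable_fun setT g.
  apply: measurableT_comp => //; apply: measurable_funD => //.
  by apply: measurable_funD => //; exact: measurable_funX.
have g0 p : (0 <= g p)%E by exact: h0.
pose g' u := (\int[mu]_b g (u, b))%E.
rewrite (@ge0_integral_tconsS _ (fun u => h (v + u)))//; last first.
  by apply: measurableT_comp => //; exact: measurable_funD.
rewrite (@ge0_integral_tconsS _ g'); last 2 first.
- exact: (@measurable_fun_fubini_tonelli_F _ _ rT rT R mu g).
- by move=> u; exact: integral_ge0.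
apply: eq_integral => y _; apply: eq_integral => a _; apply: eq_integral => b _.
by rewrite /g/=; congr h; ring.
Qed.

Lemma measurable_prod_fun (phi : R -> R) (h : R -> \bar R) :
  measurable_fun setT phi -> measurable_fun setT h ->
  measurable_fun setT (fun p : rT * rT => (phi p.1)%:E * h p.2)%E.
Proof.
move=> mphi mh; apply: emeasurable_funM.
  by apply/measurable_EFinP; exact: (measurableT_comp mphi measurable_fst).
exact: (measurableT_comp mh measurable_snd).
Qed.

(** The first coordinate carries the weight, so it is split off and kept; the two coordinates
    integrated out come from the remaining [n.+2]. *)
Lemma ge0_integral_two_dims n (phi : R -> R) (h : R -> \bar R) :
  measurable_fun setT phi -> (forall s, 0 <= phi s) ->
  measurable_fun setT h -> (forall u, 0 <= h u)%E ->
  (\int[bl n.+3]_x ((phi (thead x))%:E * h (dotp x x)) =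
   \int[bl n.+1]_x ((phi (thead x))%:E *
     \int[mu]_a \int[mu]_b h (dotp x x + (a ^+ 2 + b ^+ 2))%R))%E.
Proof.
move=> mphi phi0 mh h0.
pose H v := (\int[mu]_a \int[mu]_b h (v + (a ^+ 2 + b ^+ 2))%R)%E.
have H0 v : (0 <= H v)%E by do 2 (apply: integral_ge0 => ? _).
have mH : measurable_fun setT H by exact: measurable_integral_sqr2.
rewrite (@ge0_integral_tcons1 _ (fun s u => (phi s)%:E * h u)%E); last 2 first.
- exact: measurable_prod_fun.
- by move=> s u; rewrite mule_ge0// lee_fin.
rewrite (@ge0_integral_tcons1 _ (fun s u => (phi s)%:E * H u)%E); last 2 first.
- exact: measurable_prod_fun.
- by move=> s u; rewrite mule_ge0// lee_fin.
apply: eq_integral => s _.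
rewrite !ge0_integralZl//.
- by congr (_ * _)%E; rewrite ge0_integral_tconsSS.
- exact: measurable_comp_dotp.
- by rewrite lee_fin.
- exact: measurable_comp_dotp.
- by rewrite lee_fin.
Qed.

Lemma measurable_weighted_sqr n (w : R -> R) (h : R -> \bar R) :
  measurable_fun setT w -> measurable_fun setT h ->
  measurable_fun setT (fun p : rT * n.-tuple rT =>
    (w p.1)%:E * h (p.1 ^+ 2 + dotp p.2 p.2)%R)%E.
Proof.
move=> mw mh; apply: emeasurable_funM.
  by apply/measurable_EFinP; exact: (measurableT_comp mw measurable_fst).
apply: (measurableT_comp mh); apply: measurable_funD; first exact: measurable_funX.
exact: (measurableT_comp (@measurable_dotp n) measurable_snd).
Qed.

Lemma ge0_integral_weighted n (w : R -> R) (h : R -> \bar R) :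
  measurable_fun setT w -> (forall s, 0 <= w s) ->
  measurable_fun setT h -> (forall u, 0 <= h u)%E ->
  (\int[bl n.+1]_x ((w (thead x))%:E * h (dotp x x)) =
   \int[bl n]_y \int[mu]_s ((w s)%:E * h (s ^+ 2 + dotp y y)%R))%E.
Proof.
move=> mw w0 mh h0; apply: (@ge0_integral_tcons2 _ (fun s u => (w s)%:E * h u)%E).
  exact: measurable_prod_fun.
by move=> s u; rewrite mule_ge0// lee_fin.
Qed.

Lemma ge0_integral_reflect n (w : R -> R) (h : R -> \bar R) :
  measurable_fun setT w -> (forall s, 0 <= w s) ->
  measurable_fun setT h -> (forall u, 0 <= h u)%E ->
  (\int[bl n.+1]_x ((w (- thead x)%R)%:E * h (dotp x x)) =
   \int[bl n.+1]_x ((w (thead x))%:E * h (dotp x x)))%E.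
Proof.
move=> mw w0 mh h0; rewrite (@ge0_integral_weighted _ (fun s => w (- s)))//; last first.
  exact: measurableT_comp.
rewrite (ge0_integral_weighted n mw w0 mh h0); apply: eq_integral => y _.
rewrite -[RHS]ge0_integral_oppr//.
- by under [RHS]eq_integral do rewrite sqrrN.
- apply: emeasurable_funM; first exact/measurable_EFinP.
  by apply: measurableT_comp => //; apply: measurable_funD => //; exact: measurable_funX.
- by move=> s; rewrite mule_ge0// lee_fin.
Qed.

(* Write [x = (s, y)]: for fixed [y], both sides are [pi] times the integral of
   [h] over [[|y|^2, +oo[]. *)
Lemma ge0_integral_norm_weight n (h : R -> \bar R) :
  measurable_fun setT h -> (forall u, 0 <= h u)%E ->
  (\int[bl n.+2]_x h (dotp x x) =
   pi%:E * \int[bl n.+1]_x (`|thead x|%:E * h (dotp x x)))%E.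
Proof.
move=> mh h0; rewrite (@ge0_integral_weighted n (fun s : R => `|s|) h)//.
have := @ge0_integral_tconsSS n h 0 mh h0.
under eq_integral do rewrite add0r; move=> ->.
have mhd c : measurable_fun setT (fun u : R => h (u + c)).
  by apply: measurableT_comp => //; exact: measurable_funD.
rewrite -ge0_integralZl//; last 3 first.
- apply: (@measurable_fun_fubini_tonelli_G _ _ rT (n.-tuple rT) R mu
    (fun p => `|p.1|%:E * h (p.1 ^+ 2 + dotp p.2 p.2)%R)%E).
    exact: (measurable_weighted_sqr (@normr_measurable R setT) mh).
  by move=> p; rewrite mule_ge0// lee_fin.
- by move=> y _; apply: integral_ge0 => s _; rewrite mule_ge0// lee_fin.
- by rewrite lee_fin pi_ge0.
apply: eq_integral => y _; rewrite add0r.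
under eq_integral do under eq_integral do rewrite addrC.
rewrite (@ge0_integral_sqr2 _ (fun u => h (u + dotp y y)))//.
by rewrite -(@ge0_integral_sqr _ (fun u => h (u + dotp y y))).
Qed.

(** With the other coordinates fixed and c the sum of their squares, the substitution u = s^2 bounds
    the integral of |s| over the points with s^2 + c in [M] by the measure of [M]. The dimension
    must be positive: in dimension 0 the squared norm is 0 with full mass. *)
Lemma borel_lebesgue_dotp_null n (M : set R) :
  measurable (M : set rT) -> mu M = 0%E ->
  bl n.+1 ((fun x => dotp x x) @^-1` M) = 0%E.
Proof.
move=> mM M0.
have mD : measurable ((fun x : n.+1.-tuple rT => dotp x x) @^-1` M).
  by rewrite -[X in measurable X]setTI; exact: (measurable_dotp measurableT mM).
rewrite -(setIT (_ @^-1` M)) -integral_indic//.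
pose h u : \bar R := (\1_M u)%:E.
have mh : measurable_fun setT h by apply/measurable_EFinP; exact: measurable_indic.
have h0 u : (0 <= h u)%E by rewrite lee_fin.
rewrite (@ge0_integral_tconsS _ h)//.
rewrite integral0_eq// => y _.
set c := dotp y y.
have mhc : measurable_fun setT (fun u : R => h (u + c)).
  by apply: measurableT_comp => //; exact: measurable_funD.
(* The weight [`|s|] only vanishes at [s = 0] and can be dropped afterwards. *)
have : (\int[mu]_s (`|s|%:E * h (s ^+ 2 + c)%R))%E = 0%E.
  rewrite (@ge0_integral_sqr _ (fun u => h (u + c)))//.
  under eq_integral do rewrite addrC.
  rewrite ge0_integral_shift// integral_indic//.
  - apply/eqP; rewrite eq_le measure_ge0 andbT -M0.
    by apply: le_measure; rewrite ?inE//; apply: measurableI => //; exact: measurable_itv.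
have mhs : measurable_fun setT (fun s : rT => h (s ^+ 2 + c)).
  by apply: measurableT_comp mhc _; exact: measurable_funX.
have mf : measurable_fun setT (fun s : rT => `|s|%:E * h (s ^+ 2 + c)%R)%E.
  by apply: emeasurable_funM => //; apply/measurable_EFinP; exact: normr_measurable.
move=> f0; have /(ae_eq_integral_abs mu measurableT mf) :
    (\int[mu]_s abse (`|s|%:E * h (s ^+ 2 + c)%R))%E = 0%E.
  by under eq_integral do rewrite gee0_abs ?mule_ge0//.
move=> ae0.
rewrite (@ge0_ae_eq_integral _ _ _ mu setT _ (cst 0%E))//; first by rewrite integral0.
have n0 : {ae mu, forall s : rT, s <> 0}.
  exists [set 0]; split; [exact: measurable_set1|exact: lebesgue_measure_set1|].
  by move=> s /= /contrapT.
apply: filterS2 n0 ae0 => s s0 /(_ Logic.I) /= /eqP.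
by rewrite mule_eq0 eqe normr_eq0 (introF eqP s0)/= => /eqP.
Qed.

(** The nonnegative form of the passage from n to n + 2: [ge0_integral_two_dims] produces the double
    integral, and [ge0_integral_sqr3] is applied on each line parallel to the first axis. *)
Lemma ge0_integral_dimSS n (phi Psi : R -> R) (h : R -> \bar R) :
  continuous phi -> (forall s, 0 <= phi s) ->
  (forall s : R, is_derive s 1 Psi (phi s)) ->
  (forall s, Psi (- s) = - Psi s) ->
  measurable_fun setT h -> (forall u, 0 <= h u)%E ->
  (\int[bl n.+3]_x ((phi (thead x))%:E * h (dotp x x)) =
   (2 * pi)%:E * \int[bl n.+1]_x ((thead x * Psi (thead x))%:E * h (dotp x x)))%E.
Proof.
move=> cphi phi0 dPsi oPsi mh h0.
have mphi := continuous_measurable_fun cphi.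
rewrite ge0_integral_two_dims//.
pose H v := (\int[mu]_a \int[mu]_b h (v + (a ^+ 2 + b ^+ 2))%R)%E.
have H0 v : (0 <= H v)%E by do 2 (apply: integral_ge0 => ? _).
have mH : measurable_fun setT H by exact: measurable_integral_sqr2.
rewrite (@ge0_integral_tcons2 _ (fun s u => (phi s)%:E * H u)%E); last 2 first.
- exact: measurable_prod_fun.
- by move=> s u; rewrite mule_ge0// lee_fin.
have cPsi := primitive_continuous dPsi.
have Psi0 := mul_odd_primitive_ge0 cphi phi0 dPsi oPsi.
rewrite (@ge0_integral_tcons2 _ (fun s u => (s * Psi s)%:E * h u)%E); last 2 first.
- apply: (@measurable_prod_fun (fun s => s * Psi s)) => //.
  by apply: measurable_funM => //; exact: continuous_measurable_fun.
- by move=> s u; rewrite mule_ge0// lee_fin.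
rewrite -ge0_integralZl//; last 3 first.
- have mw : measurable_fun setT (fun s : R => s * Psi s).
    by apply: measurable_funM => //; exact: continuous_measurable_fun.
  apply: (@measurable_fun_fubini_tonelli_G _ _ rT (n.-tuple rT) R mu
    (fun p => (p.1 * Psi p.1)%:E * h (p.1 ^+ 2 + dotp p.2 p.2)%R)%E).
    exact: (measurable_weighted_sqr mw mh).
  by move=> p; rewrite mule_ge0// lee_fin.
- by move=> y _; apply: integral_ge0 => s _; rewrite mule_ge0// lee_fin.
- by rewrite lee_fin mulr_ge0// pi_ge0.
apply: eq_integral => y _.
have mhy : measurable_fun setT (fun u : R => h (u + dotp y y)).
  by apply: measurableT_comp => //; exact: measurable_funD.
apply: etrans (ge0_integral_sqr3 cphi phi0 dPsi oPsi mhy (fun u => h0 _)).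
apply: eq_integral => s _; congr (_ * _)%E.
apply: eq_integral => a _; apply: eq_integral => b _.
by congr h; ring.
Qed.

End tuple_integral.

(** * The cosine transform of a radial function *)

Lemma lte_mul_pinftyl (R : realType) (c : R) (x : \bar R) :
  0 < c -> (0 <= x -> c%:E * x < +oo -> x < +oo)%E.
Proof. by move=> c0; case: x => [r _ _|_|//]; rewrite ?ltry// gt0_muley ?lte_fin. Qed.

(** A positive factor fixes both infinities and [fine] sends them to 0, which settles the infinite
    cases. *)
Lemma fine_pmull (R : realType) (c : R) (x : \bar R) :
  0 < c -> fine (c%:E * x)%E = c * fine x.
Proof.
move=> c0; case: x => [r| |] //=.
  by rewrite gt0_muley ?lte_fin// mulr0.
by rewrite gt0_muleNy ?lte_fin// mulr0.
Qed.

Section cosine_transform.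
Context (R : realType).
Local Notation mu := (@lebesgue_measure R).
Local Notation rT := (measurableTypeR R).
Local Notation bl := (borel_lebesgue R).

Definition radial_integrable n (G : R -> R) :=
  (bl n).-integrable setT (fun x => (G (dotp x x))%:E).

(** The index is shifted: the space is R^(n+1), so that a first coordinate exists. For [G]
    integrable in that dimension this is the whole Fourier transform on the first axis, as the sine
    part vanishes by symmetry. *)
Definition cosint n (G : R -> R) (rho : R) : R :=
  \int[bl n.+1]_x (cos (2 * pi * rho * thead x) * G (dotp x x)).

Lemma measurable_weight_radial n (w G : R -> R) :
  measurable_fun setT w -> measurable_fun setT G ->
  measurable_fun setT (fun x : n.+1.-tuple rT => w (thead x) * G (dotp x x)).
Proof.
move=> mw mG; apply: measurable_funM.
  exact: (measurableT_comp mw (@measurable_thead R n)).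
exact: (measurableT_comp mG (@measurable_dotp R n.+1)).
Qed.

Lemma integrable_bounded_weight n (w G : R -> R) (C : R) : measurable_fun setT w ->
  (forall s, `|w s| <= C) -> measurable_fun setT G ->
  radial_integrable n.+1 G ->
  (bl n.+1).-integrable setT (fun x => (w (thead x) * G (dotp x x))%:E).
Proof.
move=> mw wC mG iG.
apply: (@le_integrable _ _ _ (bl n.+1) _ measurableT _ (fun x => (C * G (dotp x x))%:E)).
- by apply/measurable_EFinP; exact: measurable_weight_radial.
- move=> x _ /=; rewrite lee_fin !normrM ler_wpM2r//.
  by rewrite (le_trans (wC _))// ler_norm.
- by under eq_fun do rewrite EFinM; exact: integrableZl.
Qed.

(** By [ge0_integral_norm_weight], a weight [|s|] costs exactly one dimension. This is where
    integrability in the intermediate dimension enters. *)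
Lemma integrable_norm_weight n (w G : R -> R) : measurable_fun setT w ->
  (forall s, `|w s| <= `|s|) -> measurable_fun setT G ->
  radial_integrable n.+2 G ->
  (bl n.+1).-integrable setT (fun x => (w (thead x) * G (dotp x x))%:E).
Proof.
move=> mw ws mG /integrableP[_ iG].
apply/integrableP; split.
  by apply/measurable_EFinP; exact: measurable_weight_radial.
have mGn : measurable_fun setT (fun u => `|G u|%:E).
  by apply/measurable_EFinP; exact: measurableT_comp.
have /= e := @ge0_integral_norm_weight R n (fun u => `|G u|%:E) mGn (fun u => normr_ge0 _).
move: iG; rewrite e.
have pi0 := pi_gt0 R.
move=> lty.
apply: (@le_lt_trans _ _ (\int[bl n.+1]_x (`|thead x|%:E * `|G (dotp x x)|%:E))%E).
  apply: ge0_le_integral => //.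
  - apply/measurable_EFinP; apply: measurableT_comp => //.
    exact: measurable_weight_radial.
  - apply: emeasurable_funM; apply/measurable_EFinP; apply: measurableT_comp => //.
      exact: measurable_thead.
    exact: (measurableT_comp mG (@measurable_dotp R n.+1)).
  - by move=> x _; rewrite -EFinM lee_fin normrM ler_wpM2r.
apply: lte_mul_pinftyl lty => //.
by apply: integral_ge0 => x _; rewrite mule_ge0// lee_fin.
Qed.

Lemma continuous_cosM (a : R) : continuous (fun s => cos (a * s)).
Proof.
move=> x; apply: continuous_comp; last exact: continuous_cos.
by apply: cvgM; [exact: cvg_cst|exact: cvg_id].
Qed.

Lemma continuous_sinM (a : R) : continuous (fun s => sin (a * s)).
Proof.
move=> x; apply: continuous_comp; last exact: continuous_sin.
by apply: cvgM; [exact: cvg_cst|exact: cvg_id].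
Qed.

Lemma normr_cos_le1 (s : R) : `|cos s| <= 1.
Proof. by rewrite ler_norml cos_le1 cos_geN1. Qed.

Lemma normr_sin_le1 (s : R) : `|sin s| <= 1.
Proof. by rewrite ler_norml sin_le1 sin_geN1. Qed.

Lemma integrable_cos n (a : R) G : measurable_fun setT G -> radial_integrable n.+1 G ->
  (bl n.+1).-integrable setT (fun x => (cos (a * thead x) * G (dotp x x))%:E).
Proof.
move=> mG; apply: (@integrable_bounded_weight n (fun s => cos (a * s)) G 1) => //.
  exact: continuous_measurable_fun (@continuous_cosM a).
by move=> s; exact: normr_cos_le1.
Qed.

Lemma integrable_sin n (a : R) G : measurable_fun setT G -> radial_integrable n.+1 G ->
  (bl n.+1).-integrable setT (fun x => (sin (a * thead x) * G (dotp x x))%:E).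
Proof.
move=> mG; apply: (@integrable_bounded_weight n (fun s => sin (a * s)) G 1) => //.
  exact: continuous_measurable_fun (@continuous_sinM a).
by move=> s; exact: normr_sin_le1.
Qed.

Lemma integrable_mul_sin n (a : R) G : measurable_fun setT G -> radial_integrable n.+2 G ->
  (bl n.+1).-integrable setT (fun x => (thead x * sin (a * thead x) * G (dotp x x))%:E).
Proof.
move=> mG; apply: (@integrable_norm_weight n (fun s => s * sin (a * s))) => //.
  by apply: measurable_funM => //; exact: continuous_measurable_fun (@continuous_sinM a).
by move=> s; rewrite normrM -[leRHS]mulr1 ler_wpM2l// normr_sin_le1.
Qed.

(* [cos] is replaced by [1 + cos >= 0], so that Tonelli applies; the contribution
   of [1] is subtracted at the end. *)
Lemma ge0_cosint_dimSS n (G : R -> R) (a : R) : 0 < a -> measurable_fun setT G ->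
  (forall u, 0 <= G u) -> radial_integrable n.+2 G -> radial_integrable n.+3 G ->
  \int[bl n.+3]_x (cos (a * thead x) * G (dotp x x)) =
  2 * pi / a * \int[bl n.+1]_x (thead x * sin (a * thead x) * G (dotp x x)).
Proof.
move=> a0 mG G0 iG2 iG3.
pose h u := (G u)%:E.
have mh : measurable_fun setT h by exact/measurable_EFinP.
have h0 u : (0 <= h u)%E by rewrite lee_fin.
have c1 : continuous (fun _ : R => 1 : R) by move=> x; exact: cvg_cst.
have d1 (s : R) : is_derive s 1 (@id R) 1 by exact: is_derive_id.
have E1 := @ge0_integral_dimSS R n (fun=> 1) id h c1 (fun=> ler01) d1 (fun=> erefl) mh h0.
have {}E1 : (\int[bl n.+3]_x (G (dotp x x))%:E =
    (2 * pi)%:E * \int[bl n.+1]_x (thead x * thead x * G (dotp x x))%:E)%E.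
  by rewrite -[RHS]E1; apply: eq_integral => x _; rewrite mul1e.
have c2 : continuous (fun s : R => 1 + cos (a * s)).
  by move=> x; apply: cvgD; [exact: cvg_cst|exact: continuous_cosM].
have p2 s : 0 <= 1 + cos (a * s).
  by have := cos_geN1 (a * s); lra.
have d2 (s : R) : is_derive s 1 (fun s => s + sin (a * s) / a) (1 + cos (a * s)).
  by apply: is_derive_eq; rewrite /GRing.scale/=; field; rewrite gt_eqF.
have o2 s : - s + sin (a * - s) / a = - (s + sin (a * s) / a).
  by rewrite mulrN sinN mulNr opprD.
have E2 := @ge0_integral_dimSS R n _ (fun s => s + sin (a * s) / a) h c2 p2 d2 o2 mh h0.
have pi20 : 0 < 2 * pi :> R by rewrite mulr_gt0 ?pi_gt0.
(* [E1] identifies this second moment, up to the factor 2 pi, with the integral of [G] in dimension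
   [n.+3], which is finite by [iG3]. *)
have i2 : (bl n.+1).-integrable setT (fun x => (thead x * thead x * G (dotp x x))%:E).
  apply/integrableP; split.
    apply/measurable_EFinP.
    by apply: (@measurable_weight_radial n (fun s => s * s)) => //; exact: measurable_funM.
  have abs0 x : `|(thead x * thead x * G (dotp x x))%:E|%E = (thead x * thead x * G (dotp x x))%:E.
    by rewrite gee0_abs// lee_fin mulr_ge0// -expr2 sqr_ge0.
  under eq_integral do rewrite abs0.
  apply: (lte_mul_pinftyl pi20).
    by apply: integral_ge0 => x _; rewrite lee_fin mulr_ge0// -expr2 sqr_ge0.
  have /integrableP[_] := iG3; rewrite -E1; apply: le_lt_trans.
  apply: ge0_le_integral => //.
  - by move=> x _; rewrite lee_fin.
  - exact: (measurableT_comp mh (@measurable_dotp R n.+3)).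
  - apply: measurableT_comp => //.
    exact: (measurableT_comp mh (@measurable_dotp R n.+3)).
  - by move=> x _; rewrite lee_fin ler_norm.
have isin := integrable_mul_sin a mG iG2.
have icos := integrable_cos a mG iG3.
have {}E1 : \int[bl n.+3]_x G (dotp x x) =
   2 * pi * \int[bl n.+1]_x (thead x * thead x * G (dotp x x)).
  rewrite /Rintegral -fine_pmull//.
  by rewrite E1.
have {}E2 : \int[bl n.+3]_x ((1 + cos (a * thead x)) * G (dotp x x)) = 
   2 * pi * \int[bl n.+1]_x (thead x * (thead x + sin (a * thead x) / a) * G (dotp x x)).
  rewrite /Rintegral -fine_pmull//.
  by rewrite -[in RHS]E2.
have {}E2 : \int[bl n.+3]_x G (dotp x x) + \int[bl n.+3]_x (cos (a * thead x) * G (dotp x x)) =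
   2 * pi * (\int[bl n.+1]_x (thead x * thead x * G (dotp x x)) +
     a^-1 * \int[bl n.+1]_x (thead x * sin (a * thead x) * G (dotp x x))).
  rewrite -RintegralD// -RintegralZl// -RintegralD//; last first.
    exact: (integrableZl measurableT a^-1 isin).
  transitivity (\int[bl n.+3]_x ((1 + cos (a * thead x)) * G (dotp x x))).
    by apply: eq_Rintegral => x _; rewrite mulrDl mul1r.
  rewrite E2; congr (_ * _); apply: eq_Rintegral => x _.
  by ring.
apply: (@addrI _ (\int[bl n.+3]_x G (dotp x x))).
by rewrite E2 E1; ring.
Qed.

Lemma radial_integrable_le n (G H : R -> R) : measurable_fun setT G ->
  (forall u, `|G u| <= `|H u|) -> radial_integrable n H -> radial_integrable n G.
Proof.
move=> mG GH; apply: le_integrable => //.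
  by apply/measurable_EFinP; exact: (measurableT_comp mG (@measurable_dotp R n)).
by move=> x _ /=; rewrite lee_fin.
Qed.

Lemma funrpos_norm_le (G : R -> R) u : `|G^\+%R u| <= `|G u|.
Proof. by rewrite ger0_norm// /funrpos ge_max ler_norm normr_ge0. Qed.

Lemma funrneg_norm_le (G : R -> R) u : `|G^\-%R u| <= `|G u|.
Proof. by rewrite ger0_norm// /funrneg ge_max -normrN ler_norm normr_ge0. Qed.

Lemma Rintegral_pos_neg n (w G : R -> R) :
  (bl n.+1).-integrable setT (fun x => (w (thead x) * G^\+%R (dotp x x))%:E) ->
  (bl n.+1).-integrable setT (fun x => (w (thead x) * G^\-%R (dotp x x))%:E) ->
  \int[bl n.+1]_x (w (thead x) * G (dotp x x)) =
  \int[bl n.+1]_x (w (thead x) * G^\+%R (dotp x x)) -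
  \int[bl n.+1]_x (w (thead x) * G^\-%R (dotp x x)).
Proof.
move=> ip im; rewrite -RintegralB//; apply: eq_Rintegral => x _.
by rewrite -mulrBr -[in LHS](funrposBneg G).
Qed.

Lemma cos_integral_dimSS n (G : R -> R) (a : R) : 0 < a -> measurable_fun setT G ->
  radial_integrable n.+2 G -> radial_integrable n.+3 G ->
  \int[bl n.+3]_x (cos (a * thead x) * G (dotp x x)) =
  2 * pi / a * \int[bl n.+1]_x (thead x * sin (a * thead x) * G (dotp x x)).
Proof.
move=> a0 mG i2 i3.
have mp : measurable_fun setT G^\+%R by exact: measurable_funrpos.
have mn : measurable_fun setT G^\-%R by exact: measurable_funrneg.
have ip k : radial_integrable k G -> radial_integrable k G^\+%R.
  by apply: radial_integrable_le => // u; exact: funrpos_norm_le.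
have im k : radial_integrable k G -> radial_integrable k G^\-%R.
  by apply: radial_integrable_le => // u; exact: funrneg_norm_le.
rewrite (@Rintegral_pos_neg _ (fun s => cos (a * s)))//; first last.
- by apply: integrable_cos => //; exact: im.
- by apply: integrable_cos => //; exact: ip.
rewrite (@Rintegral_pos_neg _ (fun s => s * sin (a * s)))//; first last.
- by apply: integrable_mul_sin => //; exact: im.
- by apply: integrable_mul_sin => //; exact: ip.
rewrite !ge0_cosint_dimSS//; [|exact: im|exact: im|exact: ip|exact: ip].
by rewrite mulrBr.
Qed.

(** The reflection of the first coordinate preserves the measure and reverses the sign of the sine.
    It is applied to 1 + sin, which is nonnegative, and the integral of [G] then cancels. *)
Lemma ge0_sin_integral0 n (G : R -> R) (a : R) : measurable_fun setT G ->
  (forall u, 0 <= G u) -> radial_integrable n.+1 G ->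
  \int[bl n.+1]_x (sin (a * thead x) * G (dotp x x)) = 0.
Proof.
move=> mG G0 iG.
pose h u := (G u)%:E.
have mh : measurable_fun setT h by exact/measurable_EFinP.
have h0 u : (0 <= h u)%E by rewrite lee_fin.
have mw : measurable_fun setT (fun s => 1 + sin (a * s)).
  apply: measurable_funD => //.
  exact: continuous_measurable_fun (@continuous_sinM a).
have w0 s : 0 <= 1 + sin (a * s) by have := sin_geN1 (a * s); lra.
have E := @ge0_integral_reflect R n (fun s => 1 + sin (a * s)) h mw w0 mh h0.
have {}E : \int[bl n.+1]_x ((1 + sin (a * - thead x)) * G (dotp x x)) =
   \int[bl n.+1]_x ((1 + sin (a * thead x)) * G (dotp x x)) by congr fine; exact: E.
have isin := integrable_sin a mG iG.
have E1 : \int[bl n.+1]_x ((1 + sin (a * thead x)) * G (dotp x x)) =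
  \int[bl n.+1]_x G (dotp x x) + \int[bl n.+1]_x (sin (a * thead x) * G (dotp x x)).
  rewrite -RintegralD//; apply: eq_Rintegral => x _.
  by rewrite mulrDl mul1r.
have E2 : \int[bl n.+1]_x ((1 + sin (a * - thead x)) * G (dotp x x)) =
  \int[bl n.+1]_x G (dotp x x) - \int[bl n.+1]_x (sin (a * thead x) * G (dotp x x)).
  rewrite -RintegralB//; apply: eq_Rintegral => x _.
  by rewrite mulrN sinN mulrDl mul1r mulNr.
by move: E; rewrite E1 E2; lra.
Qed.

Lemma sin_integral0 n (G : R -> R) (a : R) : measurable_fun setT G ->
  radial_integrable n.+1 G ->
  \int[bl n.+1]_x (sin (a * thead x) * G (dotp x x)) = 0.
Proof.
move=> mG iG.
have mp : measurable_fun setT G^\+%R by exact: measurable_funrpos.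
have mn : measurable_fun setT G^\-%R by exact: measurable_funrneg.
have ip : radial_integrable n.+1 G^\+%R.
  by apply: radial_integrable_le iG => // u; exact: funrpos_norm_le.
have im : radial_integrable n.+1 G^\-%R.
  by apply: radial_integrable_le iG => // u; exact: funrneg_norm_le.
rewrite (@Rintegral_pos_neg _ (fun s => sin (a * s)))//; try exact: integrable_sin.
by rewrite !ge0_sin_integral0// subrr.
Qed.

Lemma is_derive_cosint n (G : R -> R) (rho : R) : measurable_fun setT G ->
  radial_integrable n.+1 G -> radial_integrable n.+2 G ->
  is_derive rho 1 (cosint n G)
    (- (2 * pi) * \int[bl n.+1]_x (thead x * sin (2 * pi * rho * thead x) * G (dotp x x))).
Proof.
move=> mG i1 i2.
pose f (r : R) (x : n.+1.-tuple rT) := cos (2 * pi * r * thead x) * G (dotp x x).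
pose df (r : R) (x : n.+1.-tuple rT) :=
  - (2 * pi) * (thead x * sin (2 * pi * r * thead x) * G (dotp x x)).
have d1f x (r : R) : is_derive r 1 (f ^~ x) (df r x).
  by apply: is_derive_eq; rewrite /GRing.scale/= /df; ring.
have I : (`]rho - 1, rho + 1[%classic : set R) rho.
  by rewrite /= in_itv/=; apply/andP; split; lra.
have intf (r : R) : (`]rho - 1, rho + 1[%classic : set R) r ->
    (bl n.+1).-integrable setT (EFin \o f r).
  by move=> _; exact: integrable_cos.
have derf1 (r : R) x : (`]rho - 1, rho + 1[%classic : set R) r -> setT x -> derivable (f ^~ x) r 1.
  by move=> _ _; apply: ex_derive.
(* Since |sin| <= 1, this dominates the derivative in [r] uniformly; it is integrable by the
   hypothesis in dimension [n.+2]. *)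
pose B (x : n.+1.-tuple rT) := 2 * pi * (`|thead x| * `|G (dotp x x)|).
have pi0 := pi_ge0 R.
have B0 x : 0 <= B x by rewrite /B !mulr_ge0.
have iB : (bl n.+1).-integrable setT (EFin \o B).
  have iB0 : (bl n.+1).-integrable setT (fun x => (`|thead x| * `|G (dotp x x)|)%:E).
    apply: (@integrable_norm_weight n (fun s : R => `|s|) (fun u => `|G u|)) => //.
    - by move=> s; rewrite normr_id.
    - exact: measurableT_comp.
    - by apply: radial_integrable_le i2 => // [|u]; [exact: measurableT_comp|rewrite normr_id].
  exact: (integrableZl measurableT (2 * pi) iB0).
have dB (r : R) x : (`]rho - 1, rho + 1[%classic : set R) r -> setT x ->
    `|partial1of2 f r x| <= B x.
  move=> _ _; rewrite partial1of2E (@derive_val _ _ _ _ _ _ _ (d1f x r)).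
  have pi20 : 0 <= 2 * pi :> R by rewrite mulr_ge0.
  rewrite /df /B normrM normrN (ger0_norm pi20) ler_wpM2l// !normrM.
  by rewrite -mulrA ler_wpM2l// -[leRHS]mul1r ler_wpM2r// normr_sin_le1.
have D := derivable_under_integral measurableT I intf derf1 B0 iB dB.
have E := differentiation_under_integral measurableT I intf derf1 B0 iB dB.
apply: DeriveDef; first exact: D.
rewrite -derive1E [LHS]E -RintegralZl//; last exact: integrable_mul_sin.
apply: eq_Rintegral => x _.
by rewrite partial1of2E (@derive_val _ _ _ _ _ _ _ (d1f x rho)).
Qed.

Lemma cosint_dimSS n (G : R -> R) (rho : R) : 0 < rho -> measurable_fun setT G ->
  radial_integrable n.+1 G -> radial_integrable n.+2 G -> radial_integrable n.+3 G ->
  is_derive rho 1 (cosint n G) (- (2 * pi * rho) * cosint n.+2 G rho).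
Proof.
move=> r0 mG i1 i2 i3.
have pi0 := pi_gt0 R.
apply: (@is_derive_eq _ _ _ _ _ _ _ _ (is_derive_cosint rho mG i1 i2)).
rewrite /cosint cos_integral_dimSS ?mulr_gt0//.
set J := (\int[bl n.+1]_x _); clearbody J.
by move: (pi : R) pi0 => p p0; field; rewrite !gt_eqF.
Qed.

End cosine_transform.

(** * Iterated differentiation *)

Section iteration.
Context (R : realType).

(* With [r = k - l] and [i = l - 1], the coefficient of the formula, where
   [2 * k - l - 1 = 2 * r + i]. *)
Definition bcoef (r i : nat) : R :=
  (-1) ^+ i.+1 * (2 * r + i)`!%:R / (2 ^+ r * r`!%:R * i`!%:R).

Lemma factr_neq0 n : n`!%:R != 0 :> R.
Proof. by rewrite pnatr_eq0 -lt0n fact_gt0. Qed.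

Lemma bcoef0S i : bcoef 0 i.+1 = - bcoef 0 i.
Proof.
rewrite /bcoef !muln0 !add0n fact0 expr0 !mul1r exprS.
by rewrite !mulfK ?factr_neq0//; ring.
Qed.

Lemma bcoefS0 r : bcoef r.+1 0 = (2 * r).+1%:R * bcoef r 0.
Proof.
rewrite /bcoef !addn0 fact0 !mulr1 mulnS add2n !factS !natrM (exprS 2).
have r0 := factr_neq0 r.
have r1 : r.+1%:R != 0 :> R by rewrite pnatr_eq0.
have p0 : 2 ^+ r != 0 :> R by rewrite expf_neq0// pnatr_eq0.
have -> : (2 * r).+2%:R = 2 * r.+1%:R :> R.
  by rewrite -natrM; congr _%:R; lia.
by move: (r.+1%:R : R) r1 => a a0; field; rewrite r0 p0 a0.
Qed.

(** The two terms are the two ways to reach a summand under -1/rho d/drho: differentiating the power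
    of rho, of exponent -(2r+i+2), or differentiating the derivative of order i+1. Without the
    common factors it reads 2r+i+3 = 2(r+1) + (i+1). *)
Lemma bcoefSS r i :
  bcoef r.+1 i.+1 = (2 * r + i).+2%:R * bcoef r i.+1 - bcoef r.+1 i.
Proof.
rewrite /bcoef mulnS !addnS !addSn !factS !natrM !exprS.
have r0 := factr_neq0 r.
have i0 := factr_neq0 i.
have r1 : r.+1%:R != 0 :> R by rewrite pnatr_eq0.
have i1 : i.+1%:R != 0 :> R by rewrite pnatr_eq0.
have p0 : 2 ^+ r != 0 :> R by rewrite expf_neq0// pnatr_eq0.
have -> : (2 * r + i).+3%:R = 2 * r.+1%:R + i.+1%:R :> R.
  by rewrite -natrM -natrD; congr _%:R; lia.
move: (r.+1%:R : R) r1 (i.+1%:R : R) i1 => a a0 b b0.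
by field; rewrite r0 p0 a0 i0 b0.
Qed.

Lemma bcoef_neq0 r i : bcoef r i != 0.
Proof.
by rewrite !mulf_neq0 ?invr_eq0 ?signr_eq0 ?factr_neq0 ?mulf_neq0 ?factr_neq0 ?expf_neq0 ?pnatr_eq0.
Qed.

(** The bracket is the derivative of a summand of the formula at stage [j], with [X i] standing for
    the derivative of order [i.+1]; the left-hand side is the sum at stage [j.+1]. *)
Lemma bcoef_sum_rec j (X : nat -> R) (rho : R) : rho != 0 ->
  \sum_(i < j.+2) bcoef (j.+1 - i) i * rho ^- (2 * (j.+1 - i) + i).+1 * X i =
  - rho^-1 * \sum_(i < j.+1) bcoef (j - i) i *
   (- (2 * (j - i) + i).+1%:R * rho ^- (2 * (j - i) + i).+2 * X i
    + rho ^- (2 * (j - i) + i).+1 * X i.+1).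
Proof.
move=> rho0.
(* [B i] and [- C i] are the contributions to [X i] from differentiating the power and from
   differentiating [X i.-1]; the first is absent at [i = j.+1], the second at [i = 0]. *)
pose B (i : nat) := if (i <= j)%N then
  (2 * (j - i) + i).+1%:R * bcoef (j - i) i * rho ^- (2 * (j - i) + i).+3 * X i else 0.
pose C (i : nat) := if i is i'.+1 then
  bcoef (j - i') i' * rho ^- (2 * (j - i') + i').+2 * X i else 0.
transitivity (\sum_(i < j.+2) (B i - C i)).
  apply: eq_bigr => -[i ij] _ /=; rewrite /B /C.
  case: i ij => [_|i ij]; rewrite ?subn0.
    by rewrite subr0 !addn0 bcoefS0 mulnS add2n.
  have [ij'|ij'] := leqP i.+1 j.
    have -> : (j.+1 - i.+1 = (j - i.+1).+1)%N by lia.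
    have -> : (j - i = (j - i.+1).+1)%N by lia.
    rewrite bcoefSS.
    have -> : (2 * (j - i.+1).+1 + i.+1 = (2 * (j - i.+1) + i.+1).+2)%N by lia.
    have -> : (2 * (j - i.+1).+1 + i = (2 * (j - i.+1) + i.+1).+1)%N by lia.
    by rewrite addnS; ring.
  have ->: i = j by lia.
  rewrite !subnn bcoef0S !muln0 !add0n.
  by ring.
rewrite sumrB big_ord_recr/= [X in _ - X]big_ord_recl/=.
rewrite /B ltnn addr0 /C add0r -sumrB mulr_sumr.
apply: eq_bigr => -[i ij] _ /=; rewrite -ltnS ij /bump/=.
have : rho ^+ (2 * (j - i) + i) != 0 by rewrite expf_neq0.
rewrite !exprS; move: (rho ^+ _) => p p0.
by field; rewrite rho0 p0.
Qed.



Lemma is_derive_exprVn n (t : R) : t != 0 ->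
  is_derive t 1 (fun s => s ^- n) (- n%:R * t ^- n.+1).
Proof.
move=> t0.
have tn0 : t ^+ n != 0 by rewrite expf_neq0.
have dX : derivable (fun s : R => s ^+ n) t 1 by exact: exprn_derivable.
apply: DeriveDef; first exact: derivableV.
rewrite deriveV// exp_derive scaler1 /GRing.scale/=.
case: n tn0 dX => [|n] tn0 _; first by rewrite /= !mul0r mulr0 oppr0 mul0r.
have tm0 : t ^+ n != 0 by rewrite expf_neq0.
rewrite /= -mulr_natl !exprS; move: (t ^+ n) tm0 (n.+1%:R) => p p0 m.
by field; rewrite t0 p0.
Qed.

Section recursion.
Variables (k : nat) (F : nat -> R -> R).
Hypothesis dF : forall j (t : R), (j < k)%N -> 0 < t ->
  is_derive t 1 (F j) (- (2 * pi * t) * F j.+1 t).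

Let D i := derive1n i (F 0).

(** Both claims need a single induction: differentiating the formula at stage [j] requires the next
    derivative of [F 0] to be differentiable, and that is extracted from the same formula. *)
Lemma recursion_derivable_formula j : (j < k)%N ->
  (forall l (t : R), (l <= j)%N -> 0 < t -> derivable (D l) t 1) /\
  (forall t : R, 0 < t -> F j.+1 t = ((2 * pi) ^+ j.+1)^-1 *
    \sum_(i < j.+1) bcoef (j - i) i * t ^- (2 * (j - i) + i).+1 * D i.+1 t).
Proof.
have pi0 := pi_gt0 R.
elim: j => [|j IH] jk.
  split=> [[|//] t _ t0|t t0].
    by rewrite /D derive1n0; have := dF jk t0; case.
  have := derive_val (is_derive := dF jk t0); rewrite -derive1E => e.
  rewrite big_ord_recl big_ord0 /D derive1n1 /= e addr0 /bcoef !fact0 !muln0 !expr1 !expr0.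
  by move: (pi : R) pi0 => p p0; field; rewrite !gt_eqF.
have [IHd IHf] := IH (ltnW jk).
have near0 (t : R) : 0 < t -> \forall s \near t, 0 < s by move=> t0; exact: lt_nbhsr.
have dD l (t : R) : derivable (D l) t 1 -> is_derive t 1 (D l) (D l.+1 t).
  by move=> d; apply: (DeriveDef d); rewrite /D derive1nS derive1E.
have dsum m (t : R) : 0 < t -> (forall i, (i < m)%N -> derivable (D i.+1) t 1) ->
    is_derive t 1 (fun s => \sum_(i < m) bcoef (j - i) i * s ^- (2 * (j - i) + i).+1 * D i.+1 s)
      (\sum_(i < m) bcoef (j - i) i *
   (- (2 * (j - i) + i).+1%:R * t ^- (2 * (j - i) + i).+2 * D i.+1 t
    + t ^- (2 * (j - i) + i).+1 * D i.+2 t)).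
  move=> t0 dDt.
  rewrite (_ : (fun s => _) = \sum_(i < m) (fun s =>
      bcoef (j - i) i * s ^- (2 * (j - i) + i).+1 * D i.+1 s)); last first.
    by apply/funext => s; rewrite fct_sumE.
  apply: is_derive_sum => i.
  have d1 := dD _ _ (dDt i (ltn_ord i)).
  have d2 := is_derive_exprVn (2 * (j - i) + i).+1 (lt0r_neq0 t0).
  by apply: is_derive_eq; rewrite /GRing.scale/=; ring.
(* The formula for [F j.+1] has a nonzero coefficient in front of [D j.+1], which
   is therefore a combination of differentiable functions. *)
have dDj (t : R) : 0 < t -> derivable (D j.+1) t 1.
  move=> t0.
  pose S s := \sum_(i < j) bcoef (j - i) i * s ^- (2 * (j - i) + i).+1 * D i.+1 s.
  pose K s := ((2 * pi) ^+ j.+1 * F j.+1 s - S s) * s ^+ j.+1 * (bcoef 0 j)^-1.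
  apply: (@near_eq_derivable _ _ _ K).
    near=> s.
    have s0 : 0 < s by near: s; exact: near0.
    rewrite /K IHf// big_ord_recr/= subnn muln0 add0n -/(S s).
    have s1 : s ^+ j.+1 != 0 by rewrite expf_neq0// gt_eqF.
    have p1 : (2 * pi) ^+ j.+1 != 0 :> R by rewrite expf_neq0// gt_eqF// mulr_gt0.
    have b0 := bcoef_neq0 0 j.
    by rewrite mulVKf//; move: (S s) => S'; field; rewrite s1 b0.
  have dF1 := dF jk t0.
  have dS : derivable S t 1.
    by have [] := dsum j t t0 (fun i ij => IHd _ _ ij t0).
  have dF1' : derivable (F j.+1) t 1 by case: dF1.
  have dcF := derivableM (derivable_cst ((2 * pi) ^+ j.+1 : R) t 1) dF1'.
  have h1 := derivableM (derivableB dcF dS) (@exprn_derivable _ j.+1 t 1).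
  exact: (@derivableM _ _ _ (cst (bcoef 0 j)^-1) t 1 h1 (derivable_cst _ _ _)).
have dDl l (t : R) : (l <= j.+1)%N -> 0 < t -> derivable (D l) t 1.
  by rewrite leq_eqVlt => /predU1P[->|]; [exact: dDj|exact: IHd].
split=> // t t0.
have dF2 := dF jk t0.
have E := derive_val (is_derive := dF2).
have := dsum j.+1 t t0 (fun i ij => dDl _ _ ij t0).
set S := (fun s => _); set S' := \sum_(i < _) _ => dS.
have E2 : 'D_1 (F j.+1) t = ((2 * pi) ^+ j.+1)^-1 * S'.
  rewrite (@near_eq_derive _ _ _ _ (fun s => ((2 * pi) ^+ j.+1)^-1 * S s)); last first.
    near=> s.
    have s0 : 0 < s by near: s; exact: near0.
    by rewrite IHf.
  have dZ : is_derive t 1 (fun s => ((2 * pi) ^+ j.+1)^-1 * S s) (((2 * pi) ^+ j.+1)^-1 * S').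
    exact: is_deriveZ.
  by rewrite derive_val.
move: E; rewrite E2 => E.
transitivity (((2 * pi) ^+ j.+2)^-1 * (- t^-1 * S')); last first.
  by congr (_ * _); symmetry; exact: (bcoef_sum_rec j (fun i => D i.+1 t) (lt0r_neq0 t0)).
have p1 : (2 * pi) ^+ j.+1 != 0 :> R by rewrite expf_neq0// gt_eqF// mulr_gt0.
apply: (@mulfI _ (- (2 * pi * t))); first by rewrite oppr_eq0 !mulf_neq0// gt_eqF.
rewrite -E (exprS _ j.+1); move: (_ ^+ j.+1) p1 => q q0.
by move: (pi : R) pi0 => p p0; field; rewrite q0 !gt_eqF.
Unshelve. all: by end_near. Qed.

End recursion.

End iteration.

(** * Radial Fourier transforms *)

Section radial.
Context (R : realType).
Local Notation mu := (@lebesgue_measure R).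
Local Notation rT := (measurableTypeR R).
Local Notation bl := (borel_lebesgue R).

Lemma measurable_tcons0 : measurable_fun setT (fun s : rT => tcons (s, [tuple]) : 1.-tuple rT).
Proof.
apply: (measurableT_comp (@measurable_tcons _ rT 0)).
by apply: measurable_fun_pair.
Qed.

Lemma borel_lebesgue1 (N : set (1.-tuple rT)) : measurable N ->
  bl 1 N = mu [set s | N (tcons (s, [tuple]))].
Proof.
move=> mN.
change ((mu \x bl 0)%E (@tcons rT 0 @^-1` N) = mu [set s | N (tcons (s, [tuple]))]).
have mN' : measurable (@tcons rT 0 @^-1` N).
  by rewrite -[X in measurable X]setTI; exact: (@measurable_tcons _ rT 0).
rewrite /product_measure1 -[X in _ = mu X]setIT -integral_indic//; last first.
  by rewrite -[X in measurable X]setTI; exact: measurable_tcons0.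
apply: eq_integral => s _ /=.
rewrite diracE indicE; congr (_%:R%:E); congr nat_of_bool.
by apply/idP/idP; rewrite /xsection !inE /= ?inE.
Qed.

(** In dimension 1 the radial function restricted to the half-line is the profile itself, so a Borel
    modification there, composed with the square root, yields [U]. The variable is the squared
    radius, matching [dotp x x]. *)
Lemma radial_borel_ae (h : R -> R) :
  measurable_fun setT (fun x : lebesgue_space R 1 => h (enorm x) : rT) ->
  exists (U : R -> R) (M : set R), [/\ measurable_fun setT U,
    measurable (M : set rT), mu M = 0%E &
    forall r, 0 <= r -> ~ M (r ^+ 2) -> h r = U (r ^+ 2)].
Proof.
move=> mh.
have [g [N [mg mN N0 hg]]] := @completion_measurable_fun_ae _ _ R (bl 1) _ mh.
pose p (u : R) : 1.-tuple rT := tcons (Num.sqrt u, [tuple]).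
have mp : measurable_fun setT (p : rT -> 1.-tuple rT).
  apply: (measurableT_comp measurable_tcons0).
  by apply: continuous_measurable_fun => u; exact: sqrt_continuous.
exists (g \o p), (`[0, +oo[ `&` p @^-1` N); split.
- exact: measurableT_comp.
- apply: measurableI; first exact: measurable_itv.
  by rewrite -[X in measurable X]setTI; exact: mp.
- pose N' := [set s : rT | N (tcons (s, [tuple]))].
  have mN' : measurable N'.
    by rewrite -[X in measurable X]setTI; exact: measurable_tcons0.
  have N'0 : mu N' = 0%E by rewrite -borel_lebesgue1.
  pose k (u : R) : \bar R := (\1_N (p u))%:E.
  have mk : measurable_fun setT k.
    by apply/measurable_EFinP; apply: measurableT_comp mp; exact: measurable_indic.
  have k0 u : (0 <= k u)%E by rewrite lee_fin.
  have m0 : measurable (`[0, +oo[%classic : set rT) by exact: measurable_itv.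
  have mpN : measurable (p @^-1` N : set rT).
    by rewrite -[X in measurable X]setTI; exact: mp.
  rewrite setIC -integral_indic//.
  transitivity (\int[mu]_(u in `[0%R, +oo[) k u)%E.
    by apply: eq_integral => u _; rewrite /k !indicE; congr (nat_of_bool _)%:R%:E;
      apply/idP/idP; rewrite !inE.
  (* With u = s^2, the measure of the exceptional squared radii becomes an integral whose weight
     vanishes for s <= 0 and whose integrand vanishes for s > 0 outside the null set [N']. *)
  rewrite -ge0_integral_sqr_half//.
  rewrite (ge0_negligible_integral mN' measurableT)//; last 2 first.
  - apply: emeasurable_funM.
      by apply/measurable_EFinP; exact: measurable_maxr.
    by apply: (measurableT_comp mk); exact: measurable_funX.
  - by move=> s _; rewrite mule_ge0// lee_fin le_max lexx.
  apply: integral0_eq => s [_ nN]; case: (ltP 0 s) => s0.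
    rewrite /k indicE memNset ?mule0//; rewrite /p sqrtr_sqr gtr0_norm//.
  by rewrite max_l ?mul0e//; lra.
- move=> r r0 nM.
  have e : enorm (p (r ^+ 2)) = r.
    by rewrite /enorm dotp_tcons /dotp big_ord0 addr0 !sqrtr_sqr ger0_norm ?normr_ge0// ger0_norm.
  rewrite -[in LHS]e hg// => Np; apply: nM; split => //=.
  by rewrite in_itv/= andbT sqr_ge0.
Qed.

Lemma dotp_axis n (x : n.+1.-tuple R) rho : dotp x (axis_point n.+1 rho) = thead x * rho.
Proof.
rewrite /dotp big_ord_recl/= tnth_mktuple/= big1 ?addr0 => [|i _].
  by rewrite /thead.
by rewrite tnth_mktuple /= mulr0.
Qed.

Section borel_profile.
Variables (h U : R -> R) (M : set R).
Hypothesis mU : measurable_fun setT U.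
Hypothesis mM : measurable (M : set rT).
Hypothesis M0 : mu M = 0%E.
Hypothesis hU : forall r, 0 <= r -> ~ M (r ^+ 2) -> h r = U (r ^+ 2).

Lemma measurable_preimage_dotp n :
  measurable ((fun x : n.-tuple rT => dotp x x) @^-1` M).
Proof. by rewrite -[X in measurable X]setTI; exact: measurable_dotp. Qed.

Lemma profileE n (x : n.-tuple R) : ~ M (dotp x x) -> h (enorm x) = U (dotp x x).
Proof.
have e : enorm x ^+ 2 = dotp x x by rewrite sqr_sqrtr// dotp_ge0.
by rewrite -e; apply: hU; exact: sqrtr_ge0.
Qed.

Lemma profile_integrable n :
  measurable_fun setT (fun x : lebesgue_space R n.+1 => h (enorm x) : rT) ->
  (\int[lebesgue_tuple R n.+1]_x `|h (enorm x)|%:E < +oo)%E ->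
  radial_integrable n.+1 U.
Proof.
move=> mh ih.
have mUd : measurable_fun setT (fun x : n.+1.-tuple rT => (U (dotp x x))%:E).
  by apply/measurable_EFinP; exact: (measurableT_comp mU (@measurable_dotp R n.+1)).
apply/integrableP; split => //.
apply: le_lt_trans ih; rewrite le_eqVlt; apply/orP; left; apply/eqP; symmetry.
apply: (@integral_completion_ae _ _ R (bl n.+1) _ _ ((fun x => dotp x x) @^-1` M)).
- by apply/measurable_EFinP; exact: measurableT_comp.
- exact: measurableT_comp.
- exact: measurable_preimage_dotp.
- exact: borel_lebesgue_dotp_null.
- by move=> x nM /=; rewrite profileE.
Qed.

End borel_profile.

(** The exponential mixes cos and sin terms of both parts of [f]. Replacing these parts by [U] and
    [V] off a null set makes the sine terms integrate to 0, so real and imaginary parts decouple. *)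
Lemma radial_fourier_cosint (f : R -> R[i]) (U V : R -> R) (M N : set R) n :
  measurable_fun setT U -> measurable_fun setT V ->
  measurable (M : set rT) -> measurable (N : set rT) -> mu M = 0%E -> mu N = 0%E ->
  (forall r, 0 <= r -> ~ M (r ^+ 2) -> complex.Re (f r) = U (r ^+ 2)) ->
  (forall r, 0 <= r -> ~ N (r ^+ 2) -> complex.Im (f r) = V (r ^+ 2)) ->
  abs_integrable (radial n.+1 f) ->
  [/\ radial_integrable n.+1 U, radial_integrable n.+1 V &
   forall rho, radial_fourier n.+1 f rho = cosint n U rho +i* cosint n V rho].
Proof.
move=> mU mV mM mN M0 N0 fU fV [mRe mIm ifoo].
have mnormc : measurable_fun setT (fun x : lebesgue_space R n.+1 =>
    (ComplexField.Normc.normc (radial n.+1 f x))%:E).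
  apply/measurable_EFinP.
  rewrite (_ : (fun x => _) = fun x => Num.sqrt
      (complex.Re (radial n.+1 f x) ^+ 2 + complex.Im (radial n.+1 f x) ^+ 2)).
    apply: (measurableT_comp (continuous_measurable_fun (@sqrt_continuous R))).
    by apply: measurable_funD; exact: measurable_funX.
  by apply/funext => x; case: (radial _ _ _).
have iU : radial_integrable n.+1 U.
  apply: (profile_integrable mU mM M0 fU) => //.
  refine (le_lt_trans (ge0_le_integral _ measurableT _ _ _ _) ifoo).
  - by move=> x _; rewrite lee_fin.
  - by apply/measurable_EFinP; exact: measurableT_comp.
  - exact: mnormc.
  - move=> x _; rewrite lee_fin /radial; case: (f _) => a b /=.
    by rewrite -[leLHS]sqrtr_sqr ler_sqrt ?lerDl ?addr_ge0 ?sqr_ge0.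
have iV : radial_integrable n.+1 V.
  apply: (profile_integrable mV mN N0 fV) => //.
  refine (le_lt_trans (ge0_le_integral _ measurableT _ _ _ _) ifoo).
  - by move=> x _; rewrite lee_fin.
  - by apply/measurable_EFinP; exact: measurableT_comp.
  - exact: mnormc.
  - move=> x _; rewrite lee_fin /radial; case: (f _) => a b /=.
    by rewrite -[leLHS]sqrtr_sqr ler_sqrt ?lerDr ?addr_ge0 ?sqr_ge0.
split=> // rho.
pose a := 2 * pi * rho.
have reE x : complex.Re (radial n.+1 f x * expi (- (2 * pi * dotp x (axis_point n.+1 rho)))) =
   cos (a * thead x) * complex.Re (f (enorm x)) + sin (a * thead x) * complex.Im (f (enorm x)).
  rewrite dotp_axis /radial /expi (mulrC (thead x)) mulrA cosN sinN -/a.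
  by case: (f _) => p q /=; ring.
have imE x : complex.Im (radial n.+1 f x * expi (- (2 * pi * dotp x (axis_point n.+1 rho)))) =
   cos (a * thead x) * complex.Im (f (enorm x)) - sin (a * thead x) * complex.Re (f (enorm x)).
  rewrite dotp_axis /radial /expi (mulrC (thead x)) mulrA cosN sinN -/a.
  by case: (f _) => p q /=; ring.
pose Z := (fun x : n.+1.-tuple rT => dotp x x) @^-1` (M `|` N).
have mZ : measurable Z.
  by apply: measurable_preimage_dotp; exact: measurableU.
have Z0 : bl n.+1 Z = 0%E.
  apply: borel_lebesgue_dotp_null; first exact: measurableU.
  have : (mu (M `|` N) <= mu M + mu N)%E by exact: measureU2.
  by rewrite M0 N0 adde0 measure_le0 => /eqP.
have mc : measurable_fun setT (fun x : n.+1.-tuple rT => cos (a * thead x)).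
  exact: (measurableT_comp (continuous_measurable_fun (@continuous_cosM R a))
    (@measurable_thead R n)).
have ms : measurable_fun setT (fun x : n.+1.-tuple rT => sin (a * thead x)).
  exact: (measurableT_comp (continuous_measurable_fun (@continuous_sinM R a))
    (@measurable_thead R n)).
have mUd := measurableT_comp mU (@measurable_dotp R n.+1).
have mVd := measurableT_comp mV (@measurable_dotp R n.+1).
have mc' : measurable_fun setT (fun x : lebesgue_space R n.+1 => cos (a * thead x) : rT).
  exact: (@measurable_fun_completion _ _ R (bl n.+1)).
have ms' : measurable_fun setT (fun x : lebesgue_space R n.+1 => sin (a * thead x) : rT).
  exact: (@measurable_fun_completion _ _ R (bl n.+1)).
rewrite /radial_fourier /fourier /cintegral; congr (_ +i* _).
- transitivity (\int[bl n.+1]_x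
      (cos (a * thead x) * U (dotp x x) + sin (a * thead x) * V (dotp x x))).
    congr fine; apply: (@integral_completion_ae _ _ R (bl n.+1) _ _ Z).
    + apply/measurable_EFinP; under eq_fun do rewrite reE.
      exact: (measurable_funD (measurable_funM mc' mRe) (measurable_funM ms' mIm)).
    + apply/measurable_EFinP.
      exact: (measurable_funD (measurable_funM mc mUd) (measurable_funM ms mVd)).
    + exact: mZ.
    + exact: Z0.
    + move=> x nZ; rewrite reE (profileE fU) ?(profileE fV)// => MN;
        apply: nZ; [right|left]; exact: MN.
  rewrite RintegralD//; first by rewrite sin_integral0// addr0.
  + exact: integrable_cos.
  + exact: integrable_sin.
- transitivity (\int[bl n.+1]_x
      (cos (a * thead x) * V (dotp x x) - sin (a * thead x) * U (dotp x x))).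
    congr fine; apply: (@integral_completion_ae _ _ R (bl n.+1) _ _ Z).
    + apply/measurable_EFinP; under eq_fun do rewrite imE.
      exact: (measurable_funB (measurable_funM mc' mIm) (measurable_funM ms' mRe)).
    + apply/measurable_EFinP.
      exact: (measurable_funB (measurable_funM mc mVd) (measurable_funM ms mUd)).
    + exact: mZ.
    + exact: Z0.
    + move=> x nZ; rewrite imE (profileE fU) ?(profileE fV)// => MN;
        apply: nZ; [right|left]; exact: MN.
  rewrite RintegralB//; first by rewrite sin_integral0// subr0.
  + exact: integrable_cos.
  + exact: integrable_sin.
Qed.

End radial.

Lemma complex_combination (R : realType) (m : nat) (c : R) (a x y : nat -> R) :
  (c * \sum_(i < m) a i * x i) +i* (c * \sum_(i < m) a i * y i) =
  c%:C * \sum_(i < m) (a i)%:C * (x i +i* y i).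
Proof.
have scaleE (r p q : R) : r%:C * (p +i* q) = (r * p) +i* (r * q).
  by rewrite /real_complex_def; apply/eqP; rewrite eq_complex /= !mul0r subr0 addr0 !eqxx.
rewrite -scaleE; congr (_ * _); under [RHS]eq_bigr do rewrite scaleE.
elim: m => [|m IH]; first by rewrite !big_ord0.
by rewrite !big_ord_recr/= -IH.
Qed.

(** Both formulas are one statement with [d = 0] or [d = 1]. The recursion runs on
    [cosint (2 * j + d)], the transform in dimension 2j + d + 1, separately for the real and the
    imaginary profile. *)
Lemma radial_fourier_formula (R : realType) (k d : nat) (f : R -> R[i]) :
  (0 < k)%N ->
  (forall n : nat, (1 <= n <= 2 * k + d.+1)%N -> abs_integrable (radial n f)) ->
  cderivable_pos k (radial_fourier d.+1 f) /\
  forall rho : R, 0 < rho ->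
        radial_fourier (2 * k + d.+1) f rho =
          (((2 * pi) ^+ k)^-1)%:C *
          \sum_(1 <= l < k.+1)
            ((-1) ^+ l * (2 * k - l - 1)`!%:R /
              (2 ^+ (k - l) * (k - l)`!%:R * (l - 1)`!%:R) *
              (rho ^+ (2 * k - l))^-1)%:C *
            cderive1n l (radial_fourier d.+1 f) rho.
Proof.
move=> k0 fi.
have f1 : abs_integrable (radial 1 f) by apply: fi; lia.
have [mRe1 mIm1 _] := f1.
have [U [M [mU mM M0 fU]]] := @radial_borel_ae R (fun r => complex.Re (f r)) mRe1.
have [V [N [mV mN N0 fV]]] := @radial_borel_ae R (fun r => complex.Im (f r)) mIm1.
have H n (hn : (n < 2 * k + d.+1)%N) :=
  radial_fourier_cosint mU mV mM mN M0 N0 fU fV (fi n.+1 hn).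
have iU n : (n < 2 * k + d.+1)%N -> radial_integrable n.+1 U by move=> /H[].
have iV n : (n < 2 * k + d.+1)%N -> radial_integrable n.+1 V by move=> /H[].
have E n : (n < 2 * k + d.+1)%N ->
    radial_fourier n.+1 f = fun rho => cosint n U rho +i* cosint n V rho.
  by move=> /H[_ _ e]; apply/funext.
have dX X : measurable_fun setT X ->
    (forall n, (n < 2 * k + d.+1)%N -> radial_integrable n.+1 X) ->
    forall j (t : R), (j < k)%N -> 0 < t ->
    is_derive t 1 (cosint (2 * j + d) X) (- (2 * pi * t) * cosint (2 * j.+1 + d) X t).
  move=> mX iX j t jk t0.
  rewrite (_ : (2 * j.+1 + d = (2 * j + d).+2)%N); last by lia.
  by apply: cosint_dimSS => //; apply: iX; lia.
have dU := dX U mU iU.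
have dV := dX V mV iV.
have Ed : radial_fourier d.+1 f = fun rho => cosint (2 * 0 + d) U rho +i* cosint (2 * 0 + d) V rho.
  by rewrite E //; lia.
(* With the positive [k] written as a successor, the recursion is used at its last admissible index,
   the predecessor of the original [k]. *)
case: k k0 {fi H iU iV dX} E dU dV => // k _ E dU dV.
have [DU FU] := recursion_derivable_formula dU (leqnn _).
have [DV FV] := recursion_derivable_formula dV (leqnn _).
split.
  by move=> l t lk t0; rewrite Ed; split; [exact: DU|exact: DV].
move=> rho rho0.
rewrite (_ : (2 * k.+1 + d.+1 = (2 * k.+1 + d).+1)%N); last by lia.
rewrite E; last by lia.
rewrite FU// FV// (complex_combination _ _
  (fun i => bcoef R (k - i) i / rho ^+ (2 * (k - i) + i).+1)
  (fun i => derive1n i.+1 (cosint (2 * 0 + d) U) rho)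
  (fun i => derive1n i.+1 (cosint (2 * 0 + d) V) rho)).
(* The sum over l from 1 is reindexed by i = l - 1; with the renamed [k], the first index of [bcoef]
   is k + 1 - l = k - i. *)
congr (_ * _); rewrite big_add1/= big_mkord; apply: eq_bigr => -[i ik] _ /=.
rewrite Ed /cderive1n/=; congr (_%:C * _).
rewrite /bcoef.
have -> : (2 * k.+1 - i.+1 - 1 = 2 * (k - i) + i)%N by lia.
have -> : (2 * k.+1 - i.+1 = (2 * (k - i) + i).+1)%N by lia.
by rewrite subSS subn1.
Qed.

Theorem corollary1p2 (R : realType) (k : nat) (f : R -> R[i]) :
  (0 < k)%N ->
  (forall n : nat, (1 <= n <= 2 * k + 2)%N -> abs_integrable (radial n f)) ->
  [/\ cderivable_pos k (radial_fourier 1 f),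
      cderivable_pos k (radial_fourier 2 f) &
      forall rho : R, 0 < rho ->
        radial_fourier (2 * k + 1) f rho =
          (((2 * pi) ^+ k)^-1)%:C *
          \sum_(1 <= l < k.+1)
            ((-1) ^+ l * (2 * k - l - 1)`!%:R /
              (2 ^+ (k - l) * (k - l)`!%:R * (l - 1)`!%:R) *
              (rho ^+ (2 * k - l))^-1)%:C *
            cderive1n l (radial_fourier 1 f) rho
        /\
        radial_fourier (2 * k + 2) f rho =
          (((2 * pi) ^+ k)^-1)%:C *
          \sum_(1 <= l < k.+1)
            ((-1) ^+ l * (2 * k - l - 1)`!%:R /
              (2 ^+ (k - l) * (k - l)`!%:R * (l - 1)`!%:R) *
              (rho ^+ (2 * k - l))^-1)%:C *
            cderive1n l (radial_fourier 2 f) rho].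
Proof.
move=> k0 fi.
have [|D1 F1] := @radial_fourier_formula R k 0 f k0.
  by move=> n /andP[n1 n2]; apply: fi; rewrite n1/=; lia.
have [D2 F2] := @radial_fourier_formula R k 1 f k0 fi.
by split=> // rho rho0; split; [exact: F1|exact: F2].
Qed.
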